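(* Let $g,h$ be positive integers and let $\mathcal W=(\mathcal W(n))_n$ be a graded set with $\mathcal W(n)\subset\mathbb S_n(\mathbb R^{g+h})$. If $\mathcal W$ is bounded and has an LMI representation, and if its free projection $\pi(\mathcal W)$ is a free open semi-algebraic set, then $\pi(\mathcal W)$ has an LMI representation.
   Context: For a positive integer $g$, $\mathcal P$ denotes the free algebra of polynomials with real coefficients in freely noncommuting variables $x=(x_1,\dots,x_g)$, and $\mathcal P^{\delta\times\delta}$ the $\delta\times\delta$ matrices over $\mathcal P$. Write $p\in\mathcal P^{\delta\times\delta}$ as a finite sum $p=\sum_w p_w w$ over words $w$ with real $\delta\times\delta$ matrices $p_w$. The involution is $p^T=\sum_w p_w^T w^T$, where $w^T$ is the reversed word; $p$ is symmetric if $p^T=p$. $\mathbb S_n(\mathbb R^g)$ is the set of $g$-tuples $X$ of real symmetric $n\times n$ matrices; $p(X)=\sum_w p_w\otimes w(X)$, where $w(X)=X_{j_1}\cdots X_{j_k}$ for $w=x_{j_1}\cdots x_{j_k}$ and $\emptyset(X)=I_n$; $p(0)=p_\emptyset$. A graded set (in $g$ variables) is a sequence $\mathcal S=(\mathcal S(n))_{n\ge1}$ with $\mathcal S(n)\subset\mathbb S_n(\mathbb R^g)$; equality, unions and intersections are termwise. It is bounded if there is a constant $K$ with $\sum_j\|X_j\|\le K$ for all $n$ and $X\in\mathcal S(n)$. For symmetric matrix-valued $p$ with $p(0)$ invertible, $\mathcal D_p=(\mathcal D_p(n))_n$, where $\mathcal D_p(n)$ is the connected component containing $0$ of $\{X\in\mathbb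 S_n(\mathbb R^g):p(X)\text{ is invertible}\}$. A free basic open semi-algebraic set (containing $0$) is a graded set $\bigcap_j\mathcal D_{p_j}$ for a finite set of symmetric matrix-valued polynomials $p_j$ with $p_j(0)$ invertible. A free open semi-algebraic set (containing $0$) is a finite union of free basic open semi-algebraic sets. A monic linear pencil of size $\ell$ in $k$ variables is $L=I_\ell+\sum_{j=1}^{k}A_jx_j$ with $A_j$ real symmetric $\ell\times\ell$ matrices; $\mathcal D_L(n)=\{X\in\mathbb S_n(\mathbb R^{k}):L(X)\succ0\}$. A graded set $\mathcal C$ has an LMI representation if $\mathcal C=\mathcal D_L$ for some monic linear pencil $L$ (in the corresponding number of variables). For a graded set $\mathcal D$ with $\mathcal D(n)\subset\mathbb S_n(\mathbb R^{g+h})$, its free projection is the graded set $\pi(\mathcal D)$ with $\pi(\mathcal D)(n)=\{X\in\mathbb S_n(\mathbb R^g):\text{there is }Y\in\mathbb S_n(\mathbb R^h)\text{ with }(X,Y)\in\mathcal D(n)\}$. *)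

(* Defs.v *)
From HB Require Import structures.
From mathcomp Require Import all_boot all_order all_algebra.
From mathcomp Require Import finmap monalg.
From mathcomp Require Import all_classical all_reals all_analysis.
From mathcomp Require Import mxtens.

Import Order.TTheory GRing.Theory Num.Theory.
Import numFieldNormedType.Exports.

Local Open Scope classical_set_scope.
Local Open Scope ring_scope.

Section FreeSets.
Context {R : realType}.

(* Matrix sizes range over n >= 1, so the level of index n : nat holds the
   matrices of size n.+1.  Tuples are row vectors of matrices: their topology
   is then the product topology, and (X, Y) is row_mx X Y. *)
Definition mxtup (g n : nat) := 'rV['M[R]_n.+1]_g.

Definition symtup {g n} : set (mxtup g n) :=
  [set X | forall j, (X 0 j)^T = X 0 j].

Definition gseq (g : nat) := forall n, set (mxtup g n).

Definition graded {g} (S : gseq g) := forall n, S n `<=` symtup.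

Definition eqgseq {g} (S T : gseq g) := forall n, S n = T n.

Definition enorm {m} (v : 'cV[R]_m) : R := Num.sqrt (\sum_i v i 0 ^+ 2).

(* The library norm on matrices is the largest entry in absolute value, which
   is not comparable to the operator norm uniformly in the size. *)
Definition opnorm {m} (A : 'M[R]_m) : R :=
  sup [set enorm (A *m v) | v in [set v | enorm v <= 1]].

Definition bounded_gseq {g} (S : gseq g) :=
  exists K : R, forall n (X : mxtup g n), S n X -> \sum_j opnorm (X 0 j) <= K.

(* Square matrices over the free algebra, identified with the finitely
   supported families of matrix coefficients p_w indexed by words w. *)
Definition ncpoly (g d : nat) := {malg 'M[R]_d[{fmonom 'I_g}]}.

Definition wrev {g} (w : {fmonom 'I_g}) : {fmonom 'I_g} := FMonom (rev w).

Definition ncadj {g d} (p : ncpoly g d) : ncpoly g d :=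
  \sum_(w <- msupp p) << (mcoeff w p)^T *g wrev w >>.

Definition ncsym {g d} (p : ncpoly g d) := ncadj p = p.

Definition weval {g n} (X : mxtup g n) (w : {fmonom 'I_g}) : 'M[R]_n.+1 :=
  \prod_(j <- w) X 0 j.

Definition nceval {g d n} (p : ncpoly g d) (X : mxtup g n) : 'M[R]_(d * n.+1) :=
  \sum_(w <- msupp p) mcoeff w p *t weval X w.

Definition nc0 {g d} (p : ncpoly g d) : 'M[R]_d := mcoeff (FMonom [::]) p.

Definition invset {g d} (p : ncpoly g d) : gseq g := fun n =>
  connected_component [set X | symtup X /\ nceval p X \in unitmx] 0.

Definition free_basic_open {g} (S : gseq g) :=
  exists (k : nat) (d : 'I_k -> nat) (p : forall j, ncpoly g (d j)),
    (forall j, [/\ (0 < d j)%N, ncsym (p j) & nc0 (p j) \in unitmx]) /\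
    eqgseq S (fun n => symtup `&` \bigcap_j invset (p j) n).

(* The union is nonempty: these sets are meant to contain 0. *)
Definition free_open {g} (S : gseq g) :=
  exists (k : nat) (B : 'I_k -> gseq g),
    [/\ (0 < k)%N, forall j, free_basic_open (B j) &
        eqgseq S (fun n => \bigcup_j B j n)].

Definition posdef {m} (A : 'M[R]_m) :=
  A^T = A /\ forall v : 'cV[R]_m, v != 0 -> 0 < (v^T *m A *m v) 0 0.

Definition pencil {k l} (A : 'I_k -> 'M[R]_l) : ncpoly k l :=
  << 1%:M *g FMonom [::] >> + \sum_j << A j *g FMonom [:: j] >>.

Definition Dpencil {k l} (A : 'I_k -> 'M[R]_l) : gseq k := fun n =>
  [set X | symtup X /\ posdef (nceval (pencil A) X)].

Definition has_LMI {k} (C : gseq k) :=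
  exists (l : nat) (A : 'I_k -> 'M[R]_l),
    [/\ (0 < l)%N, forall j, (A j)^T = A j & eqgseq C (Dpencil A)].

Definition free_proj {g h} (D : gseq (g + h)) : gseq g := fun n =>
  [set X | symtup X /\
           exists Y : mxtup h n, symtup Y /\ D n (row_mx X Y)].

End FreeSets.

Arguments mxtup R g n : clear implicits.
Arguments gseq R g : clear implicits.
Arguments ncpoly R g d : clear implicits.

(* Main.v *)
(* Write P for the projection.  If P is a union of basic sets B_i and each B_i
   had a defining polynomial singular at some Z_i in P, then the direct sum of the
   Z_i would lie in P but in no B_i, because singularity passes to direct sums.
   So for one i the polynomials p_j defining B_i are all invertible on P, and,
   the segment from 0 to a boundary point X being connected, some p_j(X) is
   singular.

   If p_j(X) kills v, compress X to the span E of the vectors w(X) v, w running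
   through the words of length at most deg p_j.  The compression Y is again
   killed by p_j, so it is not in P, and a Hahn-Banach argument in the cone of
   solvable linear matrix inequalities separates it from P by a pencil L, which
   is positive semidefinite on P and satisfies L(X) q(X) v = 0 for a polynomial q
   read off from E.  This is a linear relation between the words of bounded
   length applied to v.  Pairs (X, v) are closed under direct sums, so one pair
   whose words have maximal rank satisfies only relations valid for all pairs;
   the pairs with L(0) q(X) v = 0 satisfy strictly more relations, and induction
   on the rank yields finitely many pencils, one of which is singular at any given
   boundary point.  Their direct sum defines P. *)

Require Import Defs.
From mathcomp Require Import all_boot all_order all_algebra.
From mathcomp Require Import ring lra.
From mathcomp Require Import finmap monalg.
From mathcomp Require Import all_classical all_reals all_analysis.
From mathcomp Require Import mxtens.

Set Implicit Arguments.
Unset Strict Implicit.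
Unset Printing Implicit Defensive.

Import Order.TTheory GRing.Theory Num.Theory.
Import numFieldNormedType.Exports.

Local Open Scope classical_set_scope.
Local Open Scope ring_scope.

(** * Trace forms of linear pencils *)

Section TraceForm.
Context {R : realType}.

Definition ip {m n} (U V : 'M[R]_(m, n)) : R := \tr (U *m V^T).

Lemma ipE m n (U V : 'M[R]_(m, n)) : ip U V = \sum_i \sum_j U i j * V i j.
Proof.
by apply: eq_bigr => i _; rewrite mxE; apply: eq_bigr => j _; rewrite mxE.
Qed.

Lemma ipC m n (U V : 'M[R]_(m, n)) : ip U V = ip V U.
Proof. by rewrite /ip -mxtrace_tr trmx_mul trmxK. Qed.

Lemma ipDl m n (U V W : 'M[R]_(m, n)) : ip (U + V) W = ip U W + ip V W.
Proof. by rewrite /ip mulmxDl mxtraceD. Qed.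

Lemma ipDr m n (U V W : 'M[R]_(m, n)) : ip W (U + V) = ip W U + ip W V.
Proof. by rewrite ipC ipDl !(ipC W). Qed.

Lemma ipZl m n a (U V : 'M[R]_(m, n)) : ip (a *: U) V = a * ip U V.
Proof. by rewrite /ip -scalemxAl mxtraceZ. Qed.

Lemma ipZr m n a (U V : 'M[R]_(m, n)) : ip U (a *: V) = a * ip U V.
Proof. by rewrite ipC ipZl ipC. Qed.

Lemma ip0l m n (U : 'M[R]_(m, n)) : ip 0 U = 0.
Proof. by rewrite /ip mul0mx mxtrace0. Qed.

Lemma ip0r m n (U : 'M[R]_(m, n)) : ip U 0 = 0.
Proof. by rewrite ipC ip0l. Qed.

Lemma ip_suml m n I (r : seq I) (P : pred I) (F : I -> 'M[R]_(m, n)) V :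
  ip (\sum_(i <- r | P i) F i) V = \sum_(i <- r | P i) ip (F i) V.
Proof. by rewrite /ip mulmx_suml raddf_sum. Qed.

Lemma ip_mull m n p (M : 'M[R]_(m, n)) (U : 'M[R]_(n, p)) V :
  ip (M *m U) V = ip U (M^T *m V).
Proof. by rewrite /ip trmx_mul trmxK mulmxA -mulmxA mxtrace_mulC. Qed.

Lemma ip_mulr m n p (M : 'M[R]_(n, p)) (U : 'M[R]_(m, n)) V :
  ip (U *m M) V = ip U (V *m M^T).
Proof. by rewrite /ip trmx_mul trmxK mulmxA. Qed.

Lemma ip_tr m n (U V : 'M[R]_(m, n)) : ip U^T V^T = ip U V.
Proof. by rewrite /ip trmxK mxtrace_mulC -/(ip V U) ipC. Qed.

Lemma ip_ge0 m n (U : 'M[R]_(m, n)) : 0 <= ip U U.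
Proof. by rewrite ipE; do 2!apply: sumr_ge0 => ? _; rewrite -expr2 sqr_ge0. Qed.

Lemma sqr_le_ip m n (U : 'M[R]_(m, n)) i j : U i j ^+ 2 <= ip U U.
Proof.
rewrite ipE (bigD1 i) //= (bigD1 j) //= -expr2 -addrA lerDl addr_ge0 //.
  by apply: sumr_ge0 => ? _; rewrite -expr2 sqr_ge0.
by do 2!apply: sumr_ge0 => ? _; rewrite -expr2 sqr_ge0.
Qed.

Lemma ip_eq0 m n (U : 'M[R]_(m, n)) : ip U U <= 0 -> U = 0.
Proof.
move=> U0; apply/matrixP => i j; rewrite mxE; apply/eqP.
by rewrite -sqrf_eq0 eq_le sqr_ge0 (le_trans (sqr_le_ip U i j)).
Qed.

Lemma ip_gt0 m n (U : 'M[R]_(m, n)) : U != 0 -> 0 < ip U U.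
Proof. by move=> U0; rewrite ltNge; apply: contraNN U0 => /ip_eq0 ->. Qed.

Lemma norm_mul_le_ip m n (U : 'M[R]_(m, n)) i j i' j' :
  `|U i j * U i' j'| <= ip U U.
Proof.
have := sqr_le_ip U i j; have := sqr_le_ip U i' j'.
move: (U i j) (U i' j') => x y hx hy.
have := sqr_ge0 (x - y); have := sqr_ge0 (x + y).
by rewrite ler_norml; nra.
Qed.

(** Expanding the form entrywise, every product of two entries of [U] is at most [ip U U], so the
    absolute values of the coefficients add up to [K]. *)
Lemma ip_mulmx_bound m n (M : 'M[R]_m) (N : 'M[R]_n) :
  exists2 K, 0 <= K & forall U : 'M[R]_(m, n), `|ip (M *m U *m N) U| <= K * ip U U.
Proof.
exists (\sum_i \sum_j \sum_k \sum_l `|M i l| * `|N k j|).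
  by do 4!apply: sumr_ge0 => ? _; rewrite mulr_ge0.
move=> U; rewrite ipE mulr_suml (le_trans (ler_norm_sum _ _ _)) // ler_sum //.
move=> i _; rewrite mulr_suml (le_trans (ler_norm_sum _ _ _)) // ler_sum //.
move=> j _; rewrite mxE !mulr_suml (le_trans (ler_norm_sum _ _ _)) // ler_sum //.
move=> k _; rewrite mxE !mulr_suml (le_trans (ler_norm_sum _ _ _)) // ler_sum //.
move=> l _; rewrite [X in `|X|](_ : _ = (M i l * N k j) * (U l k * U i j)); last by ring.
by rewrite normrM normrM ler_wpM2l ?mulr_ge0 // norm_mul_le_ip.
Qed.

(* R^k (x) R^n is represented by the k x n matrices: under this identification the
   quadratic form of the pencil I + sum_j A_j (x) X_j is ip (U + lin A X U) U. *)
Definition lin {g k n} (A : 'I_g -> 'M[R]_k) (X : 'I_g -> 'M[R]_n)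
  (U : 'M[R]_(k, n)) := \sum_j A j *m U *m X j.

Lemma linD g k n (A : 'I_g -> 'M[R]_k) (X : 'I_g -> 'M[R]_n) U V :
  lin A X (U + V) = lin A X U + lin A X V.
Proof.
by rewrite -big_split; apply: eq_bigr => j _; rewrite mulmxDr mulmxDl.
Qed.

Lemma linZ g k n (A : 'I_g -> 'M[R]_k) (X : 'I_g -> 'M[R]_n) a U :
  lin A X (a *: U) = a *: lin A X U.
Proof.
by rewrite scaler_sumr; apply: eq_bigr => j _; rewrite -scalemxAr -scalemxAl.
Qed.

Lemma lin0 g k n (A : 'I_g -> 'M[R]_k) (X : 'I_g -> 'M[R]_n) : lin A X 0 = 0.
Proof. by rewrite /lin big1 // => j _; rewrite mulmx0 mul0mx. Qed.

Lemma linX0 g k n (A : 'I_g -> 'M[R]_k) U : lin A (fun=> 0 : 'M[R]_n) U = 0.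
Proof. by rewrite /lin big1 // => j _; rewrite mulmx0. Qed.

Lemma linXD g k n (A : 'I_g -> 'M[R]_k) (X Y : 'I_g -> 'M[R]_n) U :
  lin A (fun j => X j + Y j) U = lin A X U + lin A Y U.
Proof. by rewrite -big_split; apply: eq_bigr => j _; rewrite mulmxDr. Qed.

Lemma linXZ g k n (A : 'I_g -> 'M[R]_k) (X : 'I_g -> 'M[R]_n) a U :
  lin A (fun j => a *: X j) U = a *: lin A X U.
Proof. by rewrite scaler_sumr; apply: eq_bigr => j _; rewrite -scalemxAr. Qed.

Lemma ip_lin_sym g k n (A : 'I_g -> 'M[R]_k) (X : 'I_g -> 'M[R]_n) U V :
  (forall j, (A j)^T = A j) -> (forall j, (X j)^T = X j) ->
  ip (lin A X U) V = ip U (lin A X V).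
Proof.
move=> sA sX; rewrite ip_suml [RHS]ipC ip_suml; apply: eq_bigr => j _.
by rewrite ip_mulr sX ip_mull sA mulmxA ipC.
Qed.

Lemma lin_bound g k n (A : 'I_g -> 'M[R]_k) (X : 'I_g -> 'M[R]_n) :
  exists2 K, 0 <= K & forall U, `|ip (lin A X U) U| <= K * ip U U.
Proof.
have /choice[K HK] j : exists K, 0 <= K /\
    forall U, `|ip (A j *m U *m X j) U| <= K * ip U U.
  by have [K ? ?] := ip_mulmx_bound (A j) (X j); exists K.
exists (\sum_j K j); first by apply: sumr_ge0 => j _; case: (HK j).
move=> U; rewrite ip_suml mulr_suml (le_trans (ler_norm_sum _ _ _)) // ler_sum //.
by move=> j _; case: (HK j).
Qed.

(* A nonnegative quadratic form attains its minimum at its zeros. *)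
Lemma psd_ker m n (F : 'M[R]_(m, n) -> 'M[R]_(m, n)) U0 :
  (forall U V t, F (U + t *: V) = F U + t *: F V) ->
  (forall U V, ip (F U) V = ip U (F V)) ->
  (forall U, 0 <= ip (F U) U) -> ip (F U0) U0 <= 0 -> F U0 = 0.
Proof.
move=> Flin Fsym F0 FU0; apply: ip_eq0.
set V := F U0; set a := ip V V; set b := ip (F V) V.
have b0 : 0 <= b by exact: F0.
have a0 : 0 <= a by exact: ip_ge0.
(* Moving from [U0] along [- V] makes the linear term [2 t a] outweigh [t^2 b]; the summand 1 keeps
   the denominator positive when [b = 0]. *)
pose t := - (a / (b + 1)).
have H : ip (F (U0 + t *: V)) (U0 + t *: V) = ip V U0 + 2 * (t * a) + t * t * b.
  by rewrite Flin !(ipDl, ipDr, ipZl, ipZr) (Fsym V U0) -/V -/a -/b; ring.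
have {}H : 0 <= ip V U0 + 2 * (t * a) + t * t * b by rewrite -H.
have : 0 <= 2 * (t * a) + t * t * b by move: H; rewrite -/V; lra.
have b1 : 0 < b + 1 by lra.
have -> : 2 * (t * a) + t * t * b = - (a ^+ 2 * ((b + 2) / (b + 1) ^+ 2)).
  by rewrite /t; field; lra.
rewrite oppr_ge0 => a2; have : a ^+ 2 <= 0.
  by rewrite -(pmulr_lle0 _ (_ : 0 < (b + 2) / (b + 1) ^+ 2)) // divr_gt0 ?exprn_gt0; lra.
by nra.
Qed.

End TraceForm.

(** * Full rank factors of positive semidefinite matrices *)

Section FullRankFactor.
Context {R : realType}.

(** Cholesky factorization by induction on the size. A zero pivot contributes no column, so [L]
    keeps full column rank and has the left inverse [L']. *)
Lemma psd_sqrt k (G : 'M[R]_k) : G^T = G -> (forall u : 'cV_k, 0 <= ip (G *m u) u) ->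
  exists r (L : 'M[R]_(k, r)) (L' : 'M[R]_(r, k)), G = L *m L^T /\ L' *m L = 1%:M.
Proof.
elim: k G => [|k IH]; first by exists 0, 0, 0; rewrite !thinmx0.
rewrite -add1n => G; rewrite -[G](@submxK _ 1 k 1 k).
set a := ulsubmx G; set b := ursubmx G; set b' := dlsubmx G; set D := drsubmx G.
rewrite tr_block_mx => /eq_block_mx [_ _ <- DE] G0.
have aE : a = (a 0 0)%:M by rewrite [LHS]mx11_scalar.
have quad (x : 'M[R]_1) (y : 'cV[R]_k) :
    ip (block_mx a b b^T D *m col_mx x y) (col_mx x y) =
    a 0 0 * ip x x + 2 * ip (b *m y) x + ip (D *m y) y.
  rewrite mul_block_col /ip tr_col_mx mul_col_row mxtrace_block !mulmxDl !mxtraceD.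
  rewrite -!/(ip _ _) {1}aE mul_scalar_mx ipZl [ip (b^T *m x) y]ip_mull trmxK [ip x (b *m y)]ipC; ring.
have {}G0 (x : 'M[R]_1) (y : 'cV[R]_k) : 0 <= a 0 0 * ip x x + 2 * ip (b *m y) x + ip (D *m y) y.
  by rewrite -quad; exact: G0.
have e1 : ip (1%:M : 'M[R]_1) 1%:M = 1 by rewrite /ip trmx1 mulmx1 mxtrace1.
have a0 : 0 <= a 0 0.
  by have := G0 1%:M 0; rewrite mulmx0 !ip0l mulmx0 ip0l !addr0 mulr0 addr0 e1 mulr1.
have D0 (y : 'cV[R]_k) : 0 <= ip (D *m y) y by have := G0 0 y; rewrite !ip0r mulr0 mulr0 !add0r.
(* With a zero pivot the form is linear in [x], so [b y] must vanish: otherwise a large negative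
   multiple of [b y] makes it negative. *)
have [az|an] := eqVneq (a 0 0) 0.
  have bz : b = 0.
    have Hy (y : 'cV[R]_k) : b *m y = 0.
      apply: ip_eq0; set x := b *m y; rewrite leNgt; apply/negP => xx.
      have := G0 (- ((ip (D *m y) y + 1) / ip x x) *: x) y.
      by rewrite az mul0r add0r ipZr mulNr divfK ?gt_eqF //; apply/negP; rewrite -ltNge; have := D0 y; lra.
    apply/matrixP => i j; have /matrixP/(_ i 0) := Hy (delta_mx j 0).
    by rewrite -colE !mxE.
  have [r [L [L' [DL L'L]]]] := IH D DE D0.
  exists r, (col_mx 0 L), (row_mx 0 L'); split; last first.
    by rewrite mul_row_col mul0mx add0r.
  by rewrite tr_col_mx mul_col_row trmx0 !(mul0mx, mulmx0) -DL bz trmx0 aE az raddf0.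
have ap : 0 < a 0 0 by rewrite lt_def an.
set s := Num.sqrt (a 0 0).
have sp : 0 < s by rewrite sqrtr_gt0.
have ss : s * s = a 0 0 by rewrite -expr2 sqr_sqrtr.
(* The Schur complement: its form at [y] is the minimum over [x] of the form of [G], attained at
   [x = - b y / a]. *)
pose D1 := D - (a 0 0)^-1 *: (b^T *m b).
have D1E : D1^T = D1.
  by rewrite /D1 linearB linearZ /= trmx_mul trmxK DE.
have D10 (y : 'cV[R]_k) : 0 <= ip (D1 *m y) y.
  have -> : ip (D1 *m y) y = ip (D *m y) y - (a 0 0)^-1 * ip (b *m y) (b *m y).
    rewrite /D1 mulmxBl -scalemxAl -scaleNr ipDl ipZl -mulmxA.
    by rewrite [ip (b^T *m _) _]ip_mull trmxK mulNr.
  have := G0 (- (a 0 0)^-1 *: (b *m y)) y; rewrite !(ipZl, ipZr).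
  by move=> /le_trans -> //; rewrite le_eqVlt; apply/orP; left; apply/eqP; field.
have [r [L [L' [DL L'L]]]] := IH D1 D1E D10.
exists (1 + r)%N, (block_mx s%:M 0 (s^-1 *: b^T) L).
exists (block_mx s^-1%:M 0 (- (s^-1 * s^-1) *: (L' *m b^T)) L'); split.
  rewrite tr_block_mx mulmx_block trmx0 !(mul0mx, mulmx0) !addr0 -DL.
  rewrite tr_scalar_mx -scalar_mxM ss -aE !linearZ /= trmxK mul_scalar_mx scalerA.
  rewrite mulVf ?gt_eqF // scale1r -!scalemxAl mul_mx_scalar !scalerA mulVf ?gt_eqF // scale1r.
  by congr block_mx; rewrite /D1 -ss invfM addrC subrK.
rewrite mulmx_block !(mul0mx, mulmx0) !addr0 add0r -scalar_mxM mulVf ?gt_eqF // L'L.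
rewrite mul_mx_scalar -scalemxAr scalerA mulrN mulrA divff ?gt_eqF // mul1r.
by rewrite scaleNr addNr -scalar_mx_block.
Qed.

(** Factoring the Gram matrix [V V^T = L L^T] makes the rows of [L' V] an orthonormal basis of the
    row space of [V]; tuples are compressed to this space later. *)
Lemma orthonormal_factor m n (V : 'M[R]_(m, n)) :
  exists r (L : 'M[R]_(m, r)) (L' : 'M[R]_(r, m)),
    V = L *m (L' *m V) /\ (L' *m V) *m (L' *m V)^T = 1%:M.
Proof.
have [||r [L [L' [VL L'L]]]] := @psd_sqrt m (V *m V^T).
- by rewrite trmx_mul trmxK.
- by move=> u; rewrite -mulmxA ip_mull ip_ge0.
exists r, L, L'; split; last first.
  by rewrite trmx_mul -mulmxA (mulmxA V) VL !mulmxA L'L mul1mx -trmx_mul L'L trmx1.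
apply/eqP; rewrite -subr_eq0; apply/eqP/ip_eq0.
have -> : V - L *m (L' *m V) = (1%:M - L *m L') *m V by rewrite mulmxBl mul1mx mulmxA.
rewrite /ip trmx_mul -mulmxA (mulmxA V) VL !mulmxA.
have -> : (1%:M - L *m L') *m L = 0 by rewrite mulmxBl mul1mx -mulmxA L'L mulmx1 subrr.
by rewrite !mul0mx mxtrace0.
Qed.

End FullRankFactor.

(** * Separation *)

Section Cone.
Context {R : realType}.

(** The third clause makes [e] an order unit, and the last one keeps the cone from being the whole
    space. *)
Definition proper_cone {V : lmodType R} (e : V) (C : set V) :=
  [/\ forall x y, C x -> C y -> C (x + y),
      forall a x, 0 <= a -> C x -> C (a *: x),
      forall x, exists c, C (c *: e + x) & ~ C (- e)].

Lemma proper_cone0 (V : lmodType R) (e : V) C : proper_cone e C -> C 0.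
Proof. by case=> _ CZ Ce _; have [c Cc] := Ce 0; rewrite -(scale0r (c *: e + 0)); exact: CZ. Qed.

Lemma proper_cone_ge0 (V : lmodType R) (e : V) C a :
  proper_cone e C -> C (a *: e) -> 0 <= a.
Proof.
case=> _ CZ _ Ne Ca; rewrite leNgt; apply/negP => a0; apply: Ne.
have -> : - e = (- a^-1) *: (a *: e) by rewrite scalerA mulNr mulVf ?lt_eqF // scaleN1r.
by apply: CZ => //; rewrite oppr_ge0 invr_le0 ltW.
Qed.

(* With c the infimum of the reals a such that a e - x is in C, the line through
   x - c e can be added to C. *)
Lemma proper_cone_extend1 (V : lmodType R) (e x : V) C : proper_cone e C ->
  exists c C', [/\ proper_cone e C', C `<=` C', C' (x - c *: e) & C' (c *: e - x)].
Proof.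
move=> pC; have C0 := proper_cone0 pC; have [CD CZ Ce Ne] := pC.
pose E := [set a | C (a *: e - x)]; pose c := inf E.
have [K CK] := Ce x.
have EK a : E a -> - K <= a.
  move=> Ea; rewrite -subr_ge0 opprK; apply: (proper_cone_ge0 pC).
  by have := CD _ _ Ea CK; rewrite addrACA addNr addr0 -scalerDl.
have E0 : E !=set0 by have [a] := Ce (- x); exists a.
have Elb : has_lbound E by exists (- K) => b /EK.
exists c, [set y | exists s, C (y + s *: (x - c *: e))]; split; first split.
- move=> y z [s Cs] [t Ct]; exists (s + t).
  by rewrite scalerDl addrACA; exact: CD.
- move=> a y a0 [s Cs]; exists (a * s); rewrite -scalerA -scalerDr; exact: CZ.
- by move=> y; have [a Ca] := Ce y; exists a, 0; rewrite scale0r addr0.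
(* For [s < 0], dividing by [- s] puts [c + 1/s < c] into [E]. For [s > 0], some element of [E] lies
   below [c + 1/s], and adding it yields a negative multiple of [e] in [C]. *)
- move=> [s]; have [s0|s0|->] := ltgtP s 0.
  + move=> Cs.
    have /(ge_inf Elb) : E (c + s^-1).
      rewrite /E /=; have := CZ (- s^-1) _ _ Cs; rewrite oppr_ge0 invr_le0 (ltW s0) => /(_ isT).
      rewrite scalerDr scalerA mulNr mulVf ?lt_eqF // scaleN1r opprB scalerN scaleNr opprK.
      by rewrite addrA (addrC (s^-1 *: e)) -scalerDl.
    by rewrite -/c; rewrite lerDl leNgt invr_lt0 s0.
  + move=> Cs.
    have [a Ea ac] : exists2 a, E a & a < c + s^-1.
      by apply: inf_adherent => //; rewrite ?invr_gt0 //; split.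
    have := CZ (s^-1) _ _ Cs; rewrite invr_ge0 (ltW s0) => /(_ isT).
    rewrite scalerDr scalerA mulVf ?gt_eqF // scale1r scalerN => /(CD _ _ Ea).
    have -> : a *: e - x + (- (s^-1 *: e) + (x - c *: e)) = (a - (c + s^-1)) *: e.
      by rewrite addrACA addKr -!scaleNr -!scalerDl; congr (_ *: _); ring.
    by move/(proper_cone_ge0 pC); rewrite subr_ge0 leNgt ac.
  + by rewrite scale0r addr0.
- by move=> y Cy; exists 0; rewrite scale0r addr0.
- by exists (-1); rewrite scaleN1r subrr.
- by exists 1; rewrite scale1r addrA subrK subrr.
Qed.

Lemma proper_cone_extend (V : lmodType R) (e : V) C (xs : seq V) : proper_cone e C ->
  exists C', [/\ proper_cone e C', C `<=` C' &
    forall x, x \in xs -> exists c, C' (x - c *: e) /\ C' (c *: e - x)].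
Proof.
elim: xs C => [|x xs IH] C pC; first by exists C; split.
have [c [C1 [pC1 CC1 C1x C1x']]] := proper_cone_extend1 x pC.
have [C2 [pC2 CC2 C2x]] := IH _ pC1.
exists C2; split => // [y /CC1 /CC2 //|y].
rewrite inE => /orP[/eqP ->|]; last exact: C2x.
by exists c; split; apply: CC2.
Qed.

(* In the cone extended along a basis, every G is congruent to a multiple of e. *)
Lemma proper_cone_functional m n (e : 'M[R]_(m, n)) C : proper_cone e C ->
  exists2 T, ip T e = 1 & forall G, C G -> 0 <= ip T G.
Proof.
move=> pC; pose xs := [seq delta_mx ij.1 ij.2 : 'M[R]_(m, n) | ij <- enum {: 'I_m * 'I_n}].
have [C' [pC' CC' C'xs]] := proper_cone_extend xs pC.
have [CD CZ Ce Ne] := pC'; have C0 := proper_cone0 pC'.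
have /choice[c Hc] (ij : 'I_m * 'I_n) : exists c,
    C' (delta_mx ij.1 ij.2 - c *: e) /\ C' (c *: e - delta_mx ij.1 ij.2).
  by apply: C'xs; apply/mapP; exists ij; rewrite ?mem_enum.
pose T : 'M[R]_(m, n) := \matrix_(i, j) c (i, j).
(* Both signs of each congruence are available, so an entry of [G] of either sign scales one of them
   by a nonnegative factor. *)
have HT G : C' (ip T G *: e - G).
  rewrite [G in _ - G]matrix_sum_delta ipE scaler_suml -sumrB.
  apply: (big_ind C') => // i _; rewrite scaler_suml -sumrB.
  apply: (big_ind C') => // j _; rewrite !mxE mulrC -scalerA -scalerBr.
  have [Gij|Gij] := leP 0 (G i j); first by apply: CZ => //; case: (Hc (i, j)).
  rewrite -[_ *: _]opprK -scaleNr -scalerN opprB; apply: CZ; first by rewrite oppr_ge0 ltW.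
  by case: (Hc (i, j)).
have T0 G : C' G -> 0 <= ip T G.
  by move=> /CD /(_ (HT G)); rewrite addrC subrK => /(proper_cone_ge0 pC').
exists T; last by move=> G /CC'/T0.
apply/eqP; rewrite eq_le; apply/andP; split; last first.
  by rewrite -subr_ge0; apply: (proper_cone_ge0 pC'); rewrite scalerBl scale1r; exact: HT.
rewrite -subr_ge0; apply: (proper_cone_ge0 pC'); rewrite scalerBl scale1r.
by have := HT (- e); rewrite opprK -[in ip _ _]scaleN1r ipZr mulN1r scaleNr addrC.
Qed.
End Cone.

(** * Projections of linear matrix inequalities and separating pencils *)

Section Shadow.
Context {R : realType}.

Definition symfam {g n} (X : 'I_g -> 'M[R]_n) := forall j, (X j)^T = X j.

Definition dsum {g m n} (X : 'I_g -> 'M[R]_m) (Y : 'I_g -> 'M[R]_n) (j : 'I_g) :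
  'M[R]_(m + n) := block_mx (X j) 0 0 (Y j).

Definition compress {g k n} (I : 'M[R]_(k, n)) (X : 'I_g -> 'M[R]_n) (j : 'I_g) :
  'M[R]_k := I *m X j *m I^T.

Lemma eq_lin g k n (A : 'I_g -> 'M[R]_k) (X Y : 'I_g -> 'M[R]_n) U :
  X =1 Y -> lin A X U = lin A Y U.
Proof. by move=> XY; apply: eq_bigr => j _; rewrite XY. Qed.

Lemma symfam_dsum g m n (X : 'I_g -> 'M[R]_m) (Y : 'I_g -> 'M[R]_n) :
  symfam X -> symfam Y -> symfam (dsum X Y).
Proof. by move=> sX sY j; rewrite tr_block_mx !trmx0 sX sY. Qed.

Lemma symfam_compress g k n (I : 'M[R]_(k, n)) (X : 'I_g -> 'M[R]_n) :
  symfam X -> symfam (compress I X).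
Proof. by move=> sX j; rewrite !trmx_mul trmxK sX mulmxA. Qed.

Lemma symfam0 g n : symfam (fun _ : 'I_g => 0 : 'M[R]_n).
Proof. by move=> j; rewrite trmx0. Qed.

Lemma symfamZ g n a (X : 'I_g -> 'M[R]_n) : symfam X -> symfam (fun j => a *: X j).
Proof. by move=> sX j; rewrite linearZ /= sX. Qed.

Lemma symfamD g n (X Y : 'I_g -> 'M[R]_n) :
  symfam X -> symfam Y -> symfam (fun j => X j + Y j).
Proof. by move=> sX sY j; rewrite linearD /= sX sY. Qed.

Lemma lin_dsum g k m n (A : 'I_g -> 'M[R]_k) (X : 'I_g -> 'M[R]_m)
    (Y : 'I_g -> 'M[R]_n) U V :
  lin A (dsum X Y) (row_mx U V) = row_mx (lin A X U) (lin A Y V).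
Proof.
rewrite /lin; elim/big_rec3: _ => [|j u v w _ ->]; first by rewrite row_mx0.
by rewrite mul_mx_row mul_row_block !mulmx0 addr0 add0r add_row_mx.
Qed.

Lemma ip_row_mx k m n (U U' : 'M[R]_(k, m)) (V V' : 'M[R]_(k, n)) :
  ip (row_mx U V) (row_mx U' V') = ip U U' + ip V V'.
Proof. by rewrite /ip tr_row_mx mul_row_col mxtraceD. Qed.

Lemma ip_col_mx k m n (U U' : 'M[R]_(m, k)) (V V' : 'M[R]_(n, k)) :
  ip (col_mx U V) (col_mx U' V') = ip U U' + ip V V'.
Proof. by rewrite /ip tr_col_mx mul_col_row mxtrace_block. Qed.

Lemma lin_compress g k n p (I : 'M[R]_(k, n)) (A : 'I_g -> 'M[R]_p)
    (X : 'I_g -> 'M[R]_n) U :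
  lin A (compress I X) U = lin A X (U *m I) *m I^T.
Proof. by rewrite mulmx_suml; apply: eq_bigr => j _; rewrite !mulmxA. Qed.

Section Pencil.
Variables (g h l : nat) (A : 'I_g -> 'M[R]_l) (B : 'I_h -> 'M[R]_l).

(* Unlike in mxtup, n is the matrix size itself and may be 0. *)
Definition shadow n (X : 'I_g -> 'M[R]_n) :=
  symfam X /\ exists (Y : 'I_h -> 'M[R]_n) (c : R), [/\ symfam Y, 0 < c &
    forall U : 'M[R]_(l, n), c * ip U U <= ip (U + lin A X U + lin B Y U) U].

(** The radial closure: the boundary points at which rays from 0 leave the shadow belong to it. *)
Definition shadow_cl n (X : 'I_g -> 'M[R]_n) :=
  symfam X /\ forall t, 0 <= t < 1 -> shadow (fun j => t *: X j).

Lemma shadow0 n : shadow (fun=> 0 : 'M[R]_n).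
Proof.
split; first exact: symfam0.
exists (fun=> 0), 1; split => //; first exact: symfam0.
by move=> U; rewrite !linX0 !addr0 mul1r.
Qed.

(** The same [Y] serves: half of the uniform constant [c] absorbs the perturbation, whose form is
    bounded by a multiple of [ip U U]. *)
Lemma shadow_open n (X E : 'I_g -> 'M[R]_n) : shadow X -> symfam E ->
  exists2 e, 0 < e & shadow (fun j => X j + e *: E j).
Proof.
move=> [sX [Y [c [sY c0 H]]]] sE; have [K K0 HK] := lin_bound A E.
have K1 : 0 < K + 1 by rewrite ltr_wpDl.
exists (c / 2 / (K + 1)); first by rewrite !divr_gt0.
split; first by apply: symfamD => //; exact: symfamZ.
exists Y, (c / 2); split; rewrite ?divr_gt0 // => U.
rewrite linXD linXZ; set e := _ / (K + 1).
have -> : U + (lin A X U + e *: lin A E U) + lin B Y U =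
  (U + lin A X U + lin B Y U) + e *: lin A E U by rewrite addrA -!addrA [e *: _ + _]addrC.
rewrite ipDl ipZl; have := H U; have := HK U; rewrite ler_norml => /andP[+ _].
have e0 : 0 < e by rewrite !divr_gt0.
have eK : e * K <= c / 2.
  have -> : c / 2 = e * (K + 1) by rewrite /e divfK ?gt_eqF.
  by rewrite ler_wpM2l ?lerDl // ltW.
have := ler_wpM2r (ip_ge0 U) eK; move=> h1 /(ler_wpM2l (ltW e0)); lra.
Qed.

(** The form at [(t X, t Y)] is [t] times the form at [(X, Y)] plus [(1 - t)] times [ip U U], whence
    the constant [min c 1]. *)
Lemma shadow_scale n (X : 'I_g -> 'M[R]_n) t : shadow X -> 0 <= t <= 1 ->
  shadow (fun j => t *: X j).
Proof.
move=> [sX [Y [c [sY c0 H]]]] /andP[t0 t1]; split; first exact: symfamZ.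
exists (fun j => t *: Y j), (Num.min c 1); split; first exact: symfamZ.
  by rewrite lt_min c0 ltr01.
move=> U; rewrite !linXZ; have := H U; rewrite !(ipDl, ipZl).
have m1 : Num.min c 1 <= 1 by rewrite ge_min lexx orbT.
have mc : Num.min c 1 <= c by rewrite ge_min lexx.
move=> /(ler_wpM2l t0).
have := ler_wpM2l t0 (ler_wpM2r (ip_ge0 U) mc).
have t1' : 0 <= 1 - t by lra.
by have := ler_wpM2l t1' (ler_wpM2r (ip_ge0 U) m1); lra.
Qed.

Lemma shadow_dsum m n (X : 'I_g -> 'M[R]_m) (Z : 'I_g -> 'M[R]_n) :
  shadow X -> shadow Z -> shadow (dsum X Z).
Proof.
move=> [sX [Y [c [sY c0 H]]]] [sZ [Y' [c' [sY' c'0 H']]]].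
split; first exact: symfam_dsum.
exists (dsum Y Y'), (Num.min c c'); split; first exact: symfam_dsum.
  by rewrite lt_min c0 c'0.
move=> U; rewrite -(hsubmxK U) !lin_dsum !add_row_mx !ip_row_mx mulrDr lerD //.
  by apply: le_trans (H _); rewrite ler_wpM2r ?ip_ge0 // ge_min lexx.
by apply: le_trans (H' _); rewrite ler_wpM2r ?ip_ge0 // ge_min lexx orbT.
Qed.

Lemma shadow_cl_dsum m n (X : 'I_g -> 'M[R]_m) (Z : 'I_g -> 'M[R]_n) :
  shadow_cl X -> shadow_cl Z -> shadow_cl (dsum X Z).
Proof.
move=> [sX HX] [sZ HZ]; split; first exact: symfam_dsum.
move=> t t01; rewrite (_ : (fun _ => _) = dsum (fun j => t *: X j) (fun j => t *: Z j)).
  by apply: shadow_dsum; [exact: HX|exact: HZ].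
by apply/funext => j; rewrite /dsum scale_block_mx !scaler0.
Qed.

(* The pencil is a positive functional on the cone C of the tuples (G0, G) whose form
   becomes nonnegative after adding s (1, Y) with s >= 0 and a term lin B H. *)
Lemma separating_pencil k (Y : 'I_g -> 'M[R]_k) : symfam Y -> ~ shadow Y ->
  exists (C0 : 'M[R]_k) (C : 'I_g -> 'M[R]_k),
  [/\ C0^T = C0, symfam C, \tr C0 = 1, ip C0 1%:M + \sum_j ip (C j) (Y j) <= 0 &
    forall n (X : 'I_g -> 'M[R]_n) Z, shadow X -> 0 <= ip (C0 *m Z + lin C X Z) Z].
Proof.
move=> sY nY.
pose q G0 G H (U : 'M[R]_(l, k)) := ip (U *m G0 + lin A G U + lin B H U) U.
(* Tuples [(G0, G)] are flattened to the rows of one matrix, the setting of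
   [proper_cone_functional]. *)
pose d0 (M : 'M[R]_(1 + g, k * k)) : 'M[R]_k := vec_mx (usubmx M).
pose d (M : 'M[R]_(1 + g, k * k)) j : 'M[R]_k := vec_mx (row j (dsubmx M)).
pose enc (G0 : 'M[R]_k) (G : 'I_g -> 'M[R]_k) : 'M[R]_(1 + g, k * k) :=
  col_mx (mxvec G0) (\matrix_j mxvec (G j)).
have d0E G0 G : d0 (enc G0 G) = G0 by rewrite /d0 col_mxKu mxvecK.
have dE G0 G j : d (enc G0 G) j = G j by rewrite /d col_mxKd rowK mxvecK.
have d0D x y : d0 (x + y) = d0 x + d0 y by rewrite /d0 !linearD.
have dD x y j : d (x + y) j = d x j + d y j by rewrite /d !linearD.
have d0Z a x : d0 (a *: x) = a *: d0 x by rewrite /d0 !linearZ.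
have dZ a x j : d (a *: x) j = a *: d x j by rewrite /d !linearZ.
pose C := [set M | exists s H, [/\ 0 <= s, symfam H & forall U,
  0 <= q (d0 M + s%:M) (fun j => d M j + s *: Y j) H U]].
have qD G0 G H G0' G' H' U : q (G0 + G0') (fun j => G j + G' j) (fun j => H j + H' j) U =
    q G0 G H U + q G0' G' H' U.
  by rewrite /q !linXD mulmxDr -ipDl; congr ip; rewrite (addrACA (U *m G0)) [LHS]addrACA.
have qZ a G0 G H U : q (a *: G0) (fun j => a *: G j) (fun j => a *: H j) U =
    a * q G0 G H U.
  by rewrite /q !linXZ -scalemxAr -!scalerDr ipZl.
have eq_q G0 G G' H U : G =1 G' -> q G0 G H U = q G0 G' H U.
  by move=> GG'; rewrite /q (eq_lin _ _ GG').
have pC : proper_cone (enc 1%:M (fun=> 0)) C.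
  split.
  - move=> x y [s [H [s0 sH Hx]]] [t [H' [t0 sH' Hy]]].
    exists (s + t), (fun j => H j + H' j); split; first exact: addr_ge0.
      exact: symfamD.
    move=> U; rewrite d0D raddfD /= addrACA.
    rewrite (@eq_q _ _ (fun j => (d x j + s *: Y j) + (d y j + t *: Y j))).
      by rewrite qD addr_ge0.
    by move=> j; rewrite dD scalerDl addrACA.
  - move=> a x a0 [s [H [s0 sH Hx]]].
    exists (a * s), (fun j => a *: H j); split; first exact: mulr_ge0.
      exact: symfamZ.
    move=> U; rewrite d0Z -scale_scalar_mx -scalerDr.
    rewrite (@eq_q _ _ (fun j => a *: (d x j + s *: Y j))).
      by rewrite qZ mulr_ge0.
    by move=> j; rewrite dZ scalerDr scalerA.
  - move=> x; have [K K0 HK] := lin_bound A (d x).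
    have [K' K'0 HK'] := ip_mulmx_bound (1%:M : 'M[R]_l) (d0 x).
    exists (K + K'), 0, (fun=> 0); split => //; first exact: symfam0.
    move=> U; rewrite d0D d0Z d0E (@eq_q _ _ (d x)); last first.
      by move=> j; rewrite dD dZ dE scaler0 add0r scale0r addr0.
    rewrite /q linX0 raddf0 !addr0 mulmxDr -scalemxAr mulmx1 !ipDl ipZl.
    have := HK U; have := HK' U; rewrite mul1mx !ler_norml => /andP[+ _] /andP[+ _].
    lra.
  - move=> [s [H [s0 sH HU]]]; apply: nY; split => //.
    have {}HU U : 0 <= (s - 1) * ip U U + s * ip (lin A Y U) U + ip (lin B H U) U.
      have := HU U; rewrite -scaleN1r d0Z d0E (@eq_q _ _ (fun j => s *: Y j)); last first.
        by move=> j; rewrite dZ dE scaler0 add0r.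
      rewrite /q -(scalemx1 _ s) -scalerDl -scalemxAr mulmx1 linXZ !ipDl !ipZl.
      by rewrite (addrC (-1)).
    (* If [s = 0], the form of [lin B H] dominates [ip U U], and a multiple of [H] compensates any
       [lin A Y]. If [s > 0], dividing by [s] exhibits [Y] in the shadow with constant [1/s]. *)
    have [sz|sn] := eqVneq s 0.
      have [K K0 HK] := lin_bound A Y.
      exists (fun j => K *: H j), 1; split => //; first exact: symfamZ.
      move=> U; rewrite linXZ !ipDl ipZl; have := HU U; have := HK U.
      rewrite sz ler_norml => /andP[+ _].
      by move: (ip_ge0 U); move: (ip U U) (ip _ U) (ip _ U) => i x y; nra.
    have sp : 0 < s by rewrite lt_def sn.
    exists (fun j => s^-1 *: H j), s^-1; split; rewrite ?invr_gt0 //.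
      exact: symfamZ.
    move=> U; rewrite linXZ !ipDl ipZl -(ler_pM2l sp) mulrA mulrDr mulrA divff // !mul1r.
    by have := HU U; lra.
have [T Te TC] := proper_cone_functional pC.
have encE G0 G : ip T (enc G0 G) = ip (d0 T) G0 + \sum_j ip (d T j) (G j).
  have ipv (x y : 'M[R]_k) : ip (mxvec x) (mxvec y) = ip x y.
    rewrite !ipE big_ord1 (reindex _ (curry_mxvec_bij _ _)) /= pair_bigA.
    by apply: eq_bigr => -[i j] _; rewrite !mxvecE.
  rewrite -{1}[T]vsubmxK ip_col_mx; congr (_ + _); first by rewrite -ipv vec_mxK.
  rewrite ipE; apply: eq_bigr => j _; rewrite -ipv vec_mxK ipE big_ord1.
  by apply: eq_bigr => i _; rewrite !mxE.
(* The functional is only ever paired with symmetric matrices, so its components can be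
   symmetrized. *)
pose sy (M : 'M[R]_k) := 2^-1 *: (M + M^T).
have syT M : (sy M)^T = sy M by rewrite /sy linearZ linearD /= trmxK addrC.
have syip M S : S^T = S -> ip (sy M) S = ip M S.
  by move=> SE; rewrite /sy ipZl ipDl -{2}SE ip_tr; lra.
exists (sy (d0 T)), (fun j => sy (d T j)); split; [exact: syT|by move=> j; exact: syT|..].
- have := Te; rewrite encE big1 ?addr0 => [|j _]; last by rewrite ip0r.
  by rewrite -syip ?trmx1 // /ip trmx1 mulmx1.
- rewrite syip ?trmx1 // (eq_bigr (fun j => ip (d T j) (Y j))); last by move=> j _; rewrite syip.
  (* The tuple [- (1, Y)] is in the cone, since adding [s (1, Y)] with [s = 1] gives 0. *)
  rewrite -encE -oppr_ge0 -mulN1r -ipZr; apply: TC.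
  exists 1, (fun=> 0); split => //; first exact: symfam0.
  move=> U; rewrite (@eq_q _ _ (fun=> 0)).
    by rewrite d0Z d0E scaleN1r addNr /q mulmx0 !linX0 !addr0 ip0l.
  by move=> j; rewrite dZ dE scaleN1r scale1r addNr.
- move=> n X Z [sX [Y' [c [sY' c0 HU]]]].
  (* The tuple [(Z Z^T, Z X Z^T)] is in the cone with [s = 0] and [H = Z Y' Z^T]: its form at [U] is
     the form of [(X, Y')] at [U Z]. *)
  have -> : ip (sy (d0 T) *m Z + lin (fun j => sy (d T j)) X Z) Z = ip T (enc (Z *m Z^T) (compress Z X)).
    rewrite encE ipDl ip_mulr syip ?trmx_mul ?trmxK // ip_suml; congr (_ + _).
    apply: eq_bigr => j _; rewrite !ip_mulr sX syip //.
    by rewrite !trmx_mul trmxK sX mulmxA.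
  apply: TC; exists 0, (compress Z Y'); split => //; first exact: symfam_compress.
  move=> U; rewrite (@eq_q _ _ (compress Z X)); last by move=> j; rewrite dE scale0r addr0.
  rewrite d0E raddf0 addr0 /q !lin_compress mulmxA -!mulmxDl ip_mulr trmxK.
  by apply: le_trans (HU _); rewrite mulr_ge0 ?ip_ge0 // ltW.
Qed.

End Pencil.
End Shadow.

(** * Finitely many pencils suffice *)

Section Capture.
Context {R : realType}.
Variables (g h l : nat) (A : 'I_g -> 'M[R]_l) (B : 'I_h -> 'M[R]_l).

Definition pencil_psd k (D0 : 'M[R]_k) (D : 'I_g -> 'M[R]_k) :=
  forall n (X : 'I_g -> 'M[R]_n) U, shadow A B X -> 0 <= ip (D0 *m U + lin D X U) U.

(** Under the identification behind [lin], the monic pencil with coefficients [D] is singular at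
    [X]. *)
Definition kills k (D : 'I_g -> 'M[R]_k) n (X : 'I_g -> 'M[R]_n) :=
  exists2 U, U != 0 & U + lin D X U = 0.

Lemma lin_dsuml p q n (C : 'I_g -> 'M[R]_p) (D : 'I_g -> 'M[R]_q)
    (X : 'I_g -> 'M[R]_n) U V :
  lin (dsum C D) X (col_mx U V) = col_mx (lin C X U) (lin D X V).
Proof.
rewrite /lin; elim/big_rec3: _ => [|j u v w _ ->]; first by rewrite col_mx0.
by rewrite mul_block_col !mul0mx addr0 add0r mul_col_mx add_col_mx.
Qed.

Lemma pencil_psd_zero : pencil_psd (1%:M : 'M[R]_1) (fun=> 0).
Proof.
move=> n X U _; rewrite mul1mx [lin _ _ _]big1 ?addr0 ?ip_ge0 // => j _.
by rewrite !mul0mx.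
Qed.

Lemma pencil_psd_dsum p q (C : 'I_g -> 'M[R]_p) (D : 'I_g -> 'M[R]_q) :
  pencil_psd 1%:M C -> pencil_psd 1%:M D -> pencil_psd 1%:M (dsum C D).
Proof.
move=> HC HD n X U PX; rewrite -(vsubmxK U) lin_dsuml mul1mx add_col_mx ip_col_mx.
by rewrite addr_ge0 // -[X in X + _]mul1mx; [exact: HC|exact: HD].
Qed.

Lemma kills_dsuml p q n (C : 'I_g -> 'M[R]_p) (D : 'I_g -> 'M[R]_q)
    (X : 'I_g -> 'M[R]_n) : kills C X -> kills (dsum C D) X.
Proof.
move=> [U U0 HU]; exists (col_mx U 0); first by rewrite col_mx_eq0 negb_and U0.
by rewrite lin_dsuml lin0 add_col_mx HU addr0 col_mx0.
Qed.

Lemma kills_dsumr p q n (C : 'I_g -> 'M[R]_p) (D : 'I_g -> 'M[R]_q)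
    (X : 'I_g -> 'M[R]_n) : kills D X -> kills (dsum C D) X.
Proof.
move=> [U U0 HU]; exists (col_mx 0 U); first by rewrite col_mx_eq0 negb_and U0 orbT.
by rewrite lin_dsuml lin0 add_col_mx HU addr0 col_mx0.
Qed.

Lemma pencil_psd_cl k (D0 : 'M[R]_k) D n (X : 'I_g -> 'M[R]_n) U :
  pencil_psd D0 D -> shadow_cl A B X -> 0 <= ip (D0 *m U + lin D X U) U.
Proof.
move=> HD [_ HX]; rewrite ipDl.
have H0 : 0 <= ip (D0 *m U) U.
  by have := HD _ _ U (shadow0 A B n); rewrite linX0 addr0.
rewrite leNgt; apply/negP => HN.
set a := ip _ _ in H0 HN; set b := ip _ _ in HN.
have b0 : b < 0 by lra.
(* The midpoint between the zero [a / - b] of [a + t b] and 1, where [a + t b = (a + b) / 2 < 0]. *)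
pose t := (a / - b + 1) / 2.
have ab : a / - b < 1 by rewrite ltr_pdivrMr; lra.
have ab0 : 0 <= a / - b by rewrite divr_ge0 //; lra.
have := HD _ _ U (HX t _); rewrite linXZ ipDl ipZl -/a -/b.
have -> : 0 <= t < 1 by rewrite /t; apply/andP; split; lra.
move=> /(_ isT); apply/negP; rewrite -ltNge.
have -> : a + t * b = (a + b) / 2 by rewrite /t; field; lra.
by lra.
Qed.

(* Congruence by a full rank factor of C0 makes the pencil monic. *)
Lemma monic_pencil k (C0 : 'M[R]_k) C : C0^T = C0 -> symfam C -> pencil_psd C0 C ->
  exists r (D : 'I_g -> 'M[R]_r), [/\ symfam D, pencil_psd 1%:M D &
    forall n (X : 'I_g -> 'M[R]_n) Q, C0 *m Q != 0 -> C0 *m Q + lin C X Q = 0 ->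
      kills D X].
Proof.
move=> sC0 sC HC.
have C0_ge0 (u : 'cV[R]_k) : 0 <= ip (C0 *m u) u.
  by have := HC _ _ u (shadow0 A B 1); rewrite linX0 addr0.
have [r [L [L' [C0E L'L]]]] := psd_sqrt sC0 C0_ge0.
pose Z := 1%:M - (L *m L')^T.
have C0Z : C0 *m Z = 0.
  rewrite mulmxBr mulmx1 C0E trmx_mul mulmxA -(mulmxA L) -trmx_mul L'L trmx1.
  by rewrite mulmx1 subrr.
(* [Z] projects onto the kernel of [C0]. The shadow contains small multiples of [E] and [- E], so
   the form of [C j] is squeezed to 0 on that kernel, and [psd_ker] upgrades this to
   [C j *m Z = 0]. *)
have CZ j : C j *m Z = 0.
  pose E (i : 'I_g) : 'M[R]_k := if i == j then 1%:M else 0.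
  have sE : symfam E by move=> i; rewrite /E; case: ifP => _; rewrite ?trmx1 ?trmx0.
  have linE U : lin C E U = C j *m U.
    rewrite /lin (bigD1 j) //= /E eqxx mulmx1 big1 ?addr0 // => i /negPf ->.
    by rewrite mulmx0.
  have half (F : 'I_g -> 'M[R]_k) : symfam F -> exists2 e, 0 < e &
      forall U, 0 <= ip (C0 *m U + e *: lin C F U) U.
    move=> sF; have [e e0 HF] := shadow_open (shadow0 A B k) sF.
    exists e => // U; rewrite -linXZ.
    by have := HC _ _ U HF; rewrite linXD linX0 add0r.
  have [e e0 He] := half _ sE.
  have [f f0 Hf] := half _ (symfamZ (-1) sE).
  have := Hf Z; rewrite C0Z add0r linXZ linE !ipZl mulN1r mulrN oppr_ge0 pmulr_rle0 // => CZ0.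
  have := @psd_ker R k k (fun U => C0 *m U + e *: (C j *m U)) Z.
  rewrite C0Z add0r ipZl => HK; apply: (scalerI (lt0r_neq0 e0)); rewrite scaler0.
  apply: HK.
  - move=> U V t; rewrite !mulmxDr -!scalemxAr !scalerDr addrACA; congr (_ + (_ + _)).
    by rewrite !scalerA mulrC.
  - move=> U V; rewrite !ipDl !ipDr !ipZl !ipZr !(ip_mull _ U) sC0 sC; congr (_ + _ * _); rewrite ?ip_mull ?sC0 ?sC //.
  - by move=> U; rewrite -linE; exact: He.
  - by rewrite pmulr_rle0.
have CE j : C j *m (L *m L')^T = C j.
  by apply/eqP; rewrite eq_sym -subr_eq0; have := CZ j; rewrite /Z mulmxBr mulmx1 => ->.
exists r, (compress L' C); split; first exact: symfam_compress.
- move=> n X U PX; have := HC _ _ (L'^T *m U) PX.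
  rewrite -ip_mull mulmxDr; congr (0 <= ip (_ + _) U).
    by rewrite C0E !mulmxA L'L mul1mx -trmx_mul L'L trmx1 mul1mx.
  by rewrite mulmx_sumr; apply: eq_bigr => j _; rewrite !mulmxA.
- move=> n X Q CQ HQ; exists (L^T *m Q).
    by apply: contraNneq CQ => LQ; rewrite C0E -mulmxA LQ mulmx0.
  have := congr1 (mulmx L') HQ; rewrite mulmx0 mulmxDr => <-.
  rewrite mulmxA C0E mulmxA L'L mul1mx; congr (_ + _).
  rewrite mulmx_sumr; apply: eq_bigr => j _.
  by rewrite -[in RHS](CE j) trmx_mul !mulmxA.
Qed.

Lemma kermx_rank m p q (M : 'M[R]_(m, p)) (N : 'M[R]_(m, q)) :
  (kermx M <= kermx N)%MS -> (\rank M <= \rank N)%N -> (kermx N <= kermx M)%MS.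
Proof.
move=> MN rMN; rewrite -(mxrank_leqif_sup MN) eqn_leq mxrankS //= !mxrank_ker.
by rewrite leq_sub2l.
Qed.

(** * Induction on linear relations *)

Section Noetherian.
(** In the application [V] lists the words of bounded length applied to a kernel vector of a
    polynomial at [X]. *)
Variables (N : nat) (S : forall n, ('I_g -> 'M[R]_n) -> 'M[R]_(N, n) -> Prop).
Hypothesis S_dsum : forall m n (X : 'I_g -> 'M[R]_m) (Y : 'I_g -> 'M[R]_n) V W,
  S X V -> S Y W -> S (dsum X Y) (row_mx V W).
Hypothesis S_compress : forall k n (I : 'M[R]_(k, n)) (X : 'I_g -> 'M[R]_n) V,
  I *m I^T = 1%:M -> S X (V *m I) -> S (compress I X) V.
Hypothesis S_shadow : forall n (X : 'I_g -> 'M[R]_n) V, shadow A B X -> S X V -> V = 0.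

(** Its left kernel consists of the linear relations among the rows of [V] and of all [V X_j]; a
    pencil vanishing on [Q V] is a family of such relations. *)
Let stack n (X : 'I_g -> 'M[R]_n) (V : 'M[R]_(N, n)) := col_mx V (\mxcol_j (V *m X j)).

(** Right multiplication preserves left relations, so relations of a direct sum hold for each
    summand. *)
Lemma stack_dsuml m n (X : 'I_g -> 'M[R]_m) (Y : 'I_g -> 'M[R]_n) V W :
  stack X V = stack (dsum X Y) (row_mx V W) *m col_mx 1%:M 0.
Proof.
rewrite mul_col_mx mul_row_col mulmx1 mulmx0 addr0 mxcol_mul.
congr col_mx; apply: eq_mxcol => j.
by rewrite mul_row_block mul_row_col mulmx1 !mulmx0 !addr0.
Qed.

Lemma stack_dsumr m n (X : 'I_g -> 'M[R]_m) (Y : 'I_g -> 'M[R]_n) V W :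
  stack Y W = stack (dsum X Y) (row_mx V W) *m col_mx 0 1%:M.
Proof.
rewrite mul_col_mx mul_row_col mulmx1 mulmx0 add0r mxcol_mul.
congr col_mx; apply: eq_mxcol => j.
by rewrite mul_row_block mul_row_col mulmx1 !mulmx0 !add0r.
Qed.

Lemma stack_relation k (C0 : 'M[R]_k) C (Q : 'M[R]_(k, N)) :
  exists T, forall n (X : 'I_g -> 'M[R]_n) V,
    T *m stack X V = C0 *m (Q *m V) + lin C X (Q *m V).
Proof.
exists (row_mx (C0 *m Q) (\mxrow_j (C j *m Q))) => n X V.
rewrite mul_row_col mul_mxrow_mxcol mulmxA; congr (_ + _).
by apply: eq_bigr => j _; rewrite !mulmxA.
Qed.

(* The pair (X0, V0) of maximal rank satisfies only relations common to all pairs;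
   the pencil separating its compression gives a relation C0 Q + lin C X Q = 0 with
   Q = L' V, and the pairs with C0 Q = 0 have smaller rank. *)
Lemma noetherian_capture k (P : forall n, ('I_g -> 'M[R]_n) -> 'M[R]_(N, n) -> Prop) :
  (forall n (X : 'I_g -> 'M[R]_n) V, P n X V -> [/\ shadow_cl A B X, S X V & V != 0]) ->
  (forall m n (X : 'I_g -> 'M[R]_m) (Y : 'I_g -> 'M[R]_n) V W,
     P m X V -> P n Y W -> P _ (dsum X Y) (row_mx V W)) ->
  (forall n (X : 'I_g -> 'M[R]_n) V, P n X V -> (\rank (stack X V) < k)%N) ->
  exists l' (D : 'I_g -> 'M[R]_l'), [/\ (0 < l')%N, symfam D, pencil_psd 1%:M D &
    forall n (X : 'I_g -> 'M[R]_n) V, P n X V -> kills D X].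
Proof.
elim: k P => [|k IH] P PS Pd Pr.
  exists 1%N, (fun=> 0); split => //; [exact: symfam0|exact: pencil_psd_zero|].
  by move=> n X V /Pr.
have [[n0 [X0 [V0 [P0 r0]]]]|Hno] := pselect (exists n (X : 'I_g -> 'M[R]_n) V,
    P n X V /\ \rank (stack X V) = k); last first.
  apply: IH => // n X V PX; have := Pr _ _ _ PX; rewrite ltnS leq_eqVlt => /orP[/eqP r|//].
  by exfalso; apply: Hno; exists n, X, V.
(* The direct sum with [(X, V)] is again in [P], so its rank is at most [k]; hence it satisfies
   every relation of [(X0, V0)], and so does [(X, V)]. *)
have dom n (X : 'I_g -> 'M[R]_n) V : P n X V -> (kermx (stack X0 V0) <= kermx (stack X V))%MS.
  move=> PX; have Pd0 := Pd _ _ _ _ _ _ P0 PX.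
  have : (kermx (stack X0 V0) <= kermx (stack (dsum X0 X) (row_mx V0 V)))%MS.
    apply: kermx_rank; last by rewrite r0 -ltnS; exact: Pr.
    by rewrite (stack_dsuml X0 X V0 V) sub_kermx mulmxA mulmx_ker mul0mx.
  move=> /submx_trans; apply.
  by rewrite (stack_dsumr X0 X V0 V) sub_kermx mulmxA mulmx_ker mul0mx.
have [clX0 SX0 V0n0] := PS _ _ _ P0.
have [r [L [L' [V0E]]]] := orthonormal_factor V0.
set I := L' *m V0 => II.
(* The compression satisfies [S] with [L]; inside the shadow [L], and with it [V0 = L I], would
   vanish. *)
have nY : ~ shadow A B (compress I X0).
  move=> sY; have L0 := S_shadow sY (S_compress II (eq_ind _ (S X0) SX0 _ V0E)).
  by move: V0n0; rewrite V0E L0 mul0mx eqxx.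
have [C0 [C [sC0 sC trC Cle CP]]] := separating_pencil (symfam_compress _ clX0.1) nY.
have HC : pencil_psd C0 C by move=> n X U; exact: CP.
have C0I : C0 *m I != 0.
  apply/eqP => C0I; have : C0 = 0 by rewrite -[C0]mulmx1 -II mulmxA C0I mul0mx.
  by move=> C00; move: trC; rewrite C00 mxtrace0 => /eqP; rewrite eq_sym oner_eq0.
(* The form at [I] is nonnegative because [X0] is in the closure, and at most 0 because the pencil
   separates the compression. *)
have rel0 : C0 *m I + lin C X0 I = 0.
  apply: (@psd_ker R _ _ (fun U => C0 *m U + lin C X0 U)).
  - move=> U V t; rewrite linD linZ mulmxDr -scalemxAr scalerDr.
    by rewrite addrACA.
  - move=> U V; rewrite ipDl ipDr ip_lin_sym //; last exact: clX0.1.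
    by rewrite ip_mull sC0.
  - by move=> U; exact: pencil_psd_cl.
  - apply: le_trans Cle; rewrite ipDl ip_mulr II lerD2l ip_suml.
    rewrite le_eqVlt; apply/orP; left; apply/eqP/eq_bigr => j _.
    by rewrite !ip_mulr clX0.1.
have [T TE] := stack_relation C0 C L'.
have rel n (X : 'I_g -> 'M[R]_n) V : P n X V -> C0 *m (L' *m V) + lin C X (L' *m V) = 0.
  move=> PX; rewrite -TE; apply/sub_kermxP/(submx_trans _ (dom _ _ _ PX)).
  by apply/sub_kermxP; rewrite TE.
pose P' n (X : 'I_g -> 'M[R]_n) V := P n X V /\ C0 *m (L' *m V) = 0.
have [|||l1 [D1 [l1p sD1 pD1 kD1]]] := IH P'.
- by move=> n X V [/PS].
- move=> m n X Y V W [PX HX] [PY HY]; split; first exact: Pd.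
  by rewrite mul_mx_row mul_mx_row HX HY row_mx0.
- move=> n X V [PX HX]; have := Pr _ _ _ PX; rewrite ltnS leq_eqVlt => /orP[/eqP rk|//].
  have [T' TE'] := stack_relation C0 (fun=> 0) L'.
  have lin00 m (Y : 'I_g -> 'M[R]_m) U : lin (fun=> 0 : 'M[R]_r) Y U = 0.
    by rewrite /lin big1 // => j _; rewrite !mul0mx.
  (* At rank [k] the relations of [(X, V)] and [(X0, V0)] coincide, so [C0 L' V = 0] would carry
     over to [C0 I = 0]. *)
  exfalso; move/eqP: C0I; apply.
  have := TE' _ X0 V0; rewrite lin00 addr0 => <-; apply/sub_kermxP.
  apply: (submx_trans _ (kermx_rank (dom _ _ _ PX) _)); last by rewrite r0 rk.
  by apply/sub_kermxP; rewrite TE' lin00 addr0.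
have [l2 [D2 [sD2 pD2 kD2]]] := monic_pencil sC0 sC HC.
exists (l1 + l2)%N, (dsum D1 D2); split.
- by rewrite addn_gt0 l1p.
- exact: symfam_dsum.
- exact: pencil_psd_dsum.
- move=> n X V PX; have [HX|HX] := eqVneq (C0 *m (L' *m V)) 0.
    by apply: kills_dsuml; apply: kD1; split; eassumption.
  by apply: kills_dsumr; apply: (kD2 _ _ (L' *m V)) => //; exact: rel.
Qed.

Lemma capture_pencil :
  exists l' (D : 'I_g -> 'M[R]_l'), [/\ (0 < l')%N, symfam D, pencil_psd 1%:M D &
    forall n (X : 'I_g -> 'M[R]_n) V, shadow_cl A B X -> S X V -> V != 0 -> kills D X].
Proof.
have [|||l' [D [l'p sD pD kD]]] := @noetherian_capture (N + \sum_(j < g) N).+1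
  (fun n X V => [/\ shadow_cl A B X, S X V & V != 0]).
- by [].
- move=> m n X Y V W [cX SX V0] [cY SY W0]; split; first exact: shadow_cl_dsum.
    exact: S_dsum.
  by rewrite row_mx_eq0 negb_and V0.
- by move=> n X V _; rewrite ltnS rank_leq_row.
by exists l', D; split => // n X V cX SX V0; apply: kD; split; eassumption.
Qed.

End Noetherian.
End Capture.

(** * Evaluation of free polynomials *)

Section Evaluation.
Context {R : realType}.

(** Flattening in the index order of the Kronecker product [*t]. *)
Definition rvec {d n} (U : 'M[R]_(d, n)) : 'rV[R]_(d * n) :=
  \row_k U (mxtens_unindex k).1 (mxtens_unindex k).2.

Lemma rvec_tens d n (P : 'M[R]_d) (Q : 'M[R]_n) (U : 'M[R]_(d, n)) :
  rvec U *m (P *t Q) = rvec (P^T *m U *m Q).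
Proof.
apply/rowP => k; case: (mxtens_indexP k) => i a.
rewrite !mxE mxtens_indexK /=.
rewrite (reindex (@mxtens_index d n)) /=; last first.
  by exists (@mxtens_unindex d n) => ? _; rewrite (mxtens_indexK, mxtens_unindexK).
under eq_bigr do rewrite !mxE !mxtens_indexK /=.
rewrite -(pair_bigA _ (fun i' a' => U i' a' * (P i' i * Q a' a))) exchange_big /=.
apply: eq_bigr => b _; rewrite !mxE mulr_suml; apply: eq_bigr => i' _.
by rewrite !mxE; ring.
Qed.

Lemma rvec_ip d n (U V : 'M[R]_(d, n)) : (rvec U *m (rvec V)^T) 0 0 = ip U V.
Proof.
rewrite mxE ipE pair_bigA /= (reindex (@mxtens_index d n)) /=; last first.
  by exists (@mxtens_unindex d n) => ? _; rewrite (mxtens_indexK, mxtens_unindexK).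
by apply: eq_bigr => -[i a] _; rewrite !mxE mxtens_indexK.
Qed.

Lemma rvecD d n (U V : 'M[R]_(d, n)) : rvec (U + V) = rvec U + rvec V.
Proof. by apply/rowP => k; rewrite !mxE. Qed.

Lemma rvec0 d n : rvec (0 : 'M[R]_(d, n)) = 0.
Proof. by apply/rowP => k; rewrite !mxE. Qed.

Lemma rvec_surj d n (v : 'rV[R]_(d * n)) : exists U, v = rvec U.
Proof.
exists (\matrix_(i, a) v 0 (mxtens_index (i, a))); apply/rowP => k.
by rewrite !mxE -surjective_pairing mxtens_unindexK.
Qed.

Lemma rvec_inj0 d n (U : 'M[R]_(d, n)) : rvec U = 0 -> U = 0.
Proof.
move=> /rowP U0; apply/matrixP => i a; have := U0 (mxtens_index (i, a)).
by rewrite !mxE mxtens_indexK.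
Qed.

Definition wact {g d n} (X : 'I_g -> 'M[R]_n) (V : 'M[R]_(d, n)) (w : seq 'I_g) :=
  foldl (fun V j => V *m X j) V w.

(* The action of p(X) on row vectors, see rvec_nceval; in this form X may have size 0. *)
Definition pact {g d n} (p : ncpoly R g d) (X : 'I_g -> 'M[R]_n) (V : 'M[R]_(d, n)) :=
  \sum_(w <- msupp p) (mcoeff w p)^T *m wact X V w.

Lemma mulmx_weval g d n (X : mxtup R g n) (V : 'M[R]_(d, n.+1)) (w : {fmonom 'I_g}) :
  V *m weval X w = wact (X 0) V w.
Proof.
rewrite /weval; elim: (w : seq 'I_g) V => [|j s IH] V; first by rewrite big_nil mulmx1.
by rewrite big_cons -mulmxE mulmxA IH.
Qed.

Lemma rvec_nceval g d n (p : ncpoly R g d) (X : mxtup R g n) U :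
  rvec U *m nceval p X = rvec (pact p (X 0) U).
Proof.
rewrite /nceval mulmx_sumr (big_morph rvec (@rvecD d n.+1) (@rvec0 _ _)).
by apply: eq_bigr => w _; rewrite rvec_tens -mulmxA mulmx_weval.
Qed.

Lemma nceval_unitPn g d n (p : ncpoly R g d) (X : mxtup R g n) :
  nceval p X \notin unitmx <-> exists2 U, U != 0 & pact p (X 0) U = 0.
Proof.
rewrite unitmxE unitfE negbK; split=> [/det0P[v v0]|[U U0 HU]].
  have [U vE] := rvec_surj v; rewrite vE rvec_nceval => /rvec_inj0 HU.
  by exists U => //; apply: contraNneq v0 => U0; rewrite vE U0 rvec0.
apply/det0P; exists (rvec U); last by rewrite rvec_nceval HU rvec0.
by apply: contraNneq U0 => /rvec_inj0 ->.
Qed.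

Lemma ncevalEw g d n (p : ncpoly R g d) (X : mxtup R g n) (E : {fset {fmonom 'I_g}}) :
  (msupp p `<=` E)%fset -> nceval p X = \sum_(w <- E) mcoeff w p *t weval X w.
Proof.
move=> pE; apply: big_fset_incl => // w _ /mcoeff_outdom ->.
by rewrite tens0mx.
Qed.

Lemma tensmxDl (m n p q : nat) (P Q : 'M[R]_(m, n)) (M : 'M[R]_(p, q)) :
  (P + Q) *t M = P *t M + Q *t M.
Proof. by apply/matrixP => i j; rewrite !mxE mulrDl. Qed.

Lemma ncevalD g d n (p q : ncpoly R g d) (X : mxtup R g n) :
  nceval (p + q) X = nceval p X + nceval q X.
Proof.
rewrite (ncevalEw X (msuppD_le p q)) (ncevalEw X (fsubsetUl (msupp p) (msupp q))).
rewrite (ncevalEw X (fsubsetUr (msupp p) (msupp q))) -big_split.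
by apply: eq_bigr => w _; rewrite mcoeffD tensmxDl.
Qed.

Lemma nceval0 g d n (X : mxtup R g n) : nceval (0 : ncpoly R g d) X = 0.
Proof. by rewrite /nceval msupp0 big_seq_fset0. Qed.

Lemma ncevalU g d n (c : 'M[R]_d) w (X : mxtup R g n) :
  nceval << c *g w >> X = c *t weval X w.
Proof. by rewrite (ncevalEw X msuppU_le) big_seq_fset1 mcoeffUU. Qed.

Lemma nceval_pencil g l n (A : 'I_g -> 'M[R]_l) (X : mxtup R g n) :
  nceval (pencil A) X = 1%:M *t 1%:M + \sum_j A j *t X 0 j.
Proof.
rewrite ncevalD ncevalU (big_morph (fun p => nceval p X) (fun p q => ncevalD p q X) (nceval0 l X)).
rewrite /weval big_nil; congr (_ + _); apply: eq_bigr => j _.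
by rewrite ncevalU /weval big_seq1.
Qed.

Lemma rvec_pencil g l n (A : 'I_g -> 'M[R]_l) (X : mxtup R g n) U : symfam A ->
  rvec U *m nceval (pencil A) X = rvec (U + lin A (X 0) U).
Proof.
move=> sA; rewrite nceval_pencil mulmxDr rvec_tens trmx1 mul1mx mulmx1 rvecD.
rewrite mulmx_sumr (big_morph rvec (@rvecD l n.+1) (@rvec0 _ _)).
by congr (_ + _); apply: eq_bigr => j _; rewrite rvec_tens sA.
Qed.

Lemma posdef_pencilP g l n (A : 'I_g -> 'M[R]_l) (X : mxtup R g n) :
  symfam A -> symtup X ->
  posdef (nceval (pencil A) X) <-> (forall U, U != 0 -> 0 < ip (U + lin A (X 0) U) U).
Proof.
move=> sA sX; split=> [[_ H] U U0|H].
  have := H (rvec U)^T; rewrite trmxK rvec_pencil // rvec_ip; apply.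
  by rewrite trmx_eq0; apply: contraNneq U0 => /rvec_inj0 ->.
split=> [|v v0].
  rewrite nceval_pencil linearD /= trmx_tens !trmx1; congr (_ + _).
  by rewrite linear_sum; apply: eq_bigr => j _; rewrite /= trmx_tens sA sX.
have [U vE] := rvec_surj v^T; rewrite -[v in _ *m v]trmxK vE rvec_pencil // rvec_ip.
by apply: H; apply: contraNneq v0 => U0; rewrite -trmx_eq0 vE U0 rvec0.
Qed.

(** Supplies the constant [c] of [shadow]. With [M = L L^T], definiteness makes [L^T] injective with
    left inverse [L'^T], so [ip v v] is at most a multiple of the form. *)
Lemma posdef_uniform m (M : 'M[R]_m) : posdef M ->
  exists2 c, 0 < c & forall v : 'rV[R]_m, c * ip v v <= (v *m M *m v^T) 0 0.
Proof.
move=> [sM M0].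
have ME (v : 'cV[R]_m) : ip (M *m v) v = (v^T *m M *m v) 0 0.
  by rewrite /ip mxtrace_mulC [LHS]trace_mx11 mulmxA.
have [|r [L [L' [ME' L'L]]]] := psd_sqrt sM.
  move=> v; rewrite ME; have [->|v0] := eqVneq v 0; last exact/ltW/M0.
  by rewrite mulmx0 mxE.
have ML (v : 'cV[R]_m) : ip (M *m v) v = ip (L^T *m v) (L^T *m v).
  by rewrite ME' -mulmxA ip_mull.
have vE (v : 'cV[R]_m) : v = L'^T *m (L^T *m v).
  apply/eqP; rewrite -subr_eq0; apply: contraT => v0; have := M0 _ v0; rewrite -ME ML.
  rewrite mulmxBr (mulmxA L^T) -[L^T *m L'^T]trmx_mul L'L trmx1 mul1mx subrr.
  by rewrite ip0l ltxx.
have [K K0 HK] := ip_mulmx_bound (L' *m L'^T) (1%:M : 'M[R]_1).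
have K1 : 0 < K + 1 by rewrite ltr_wpDl.
exists (K + 1)^-1; first by rewrite invr_gt0.
move=> v; rewrite ler_pdivrMl // -[X in _ *m X *m _]trmxK.
have -> : (v *m M^T^T *m v^T) 0 0 = ip (M *m v^T) v^T by rewrite ME !trmxK.
rewrite ML -(ip_tr v) {1 2}(vE v^T) ip_mull trmxK mulmxA.
have := HK (L^T *m v^T); rewrite mulmx1 => /(le_trans (ler_norm _)) h.
rewrite ipC (le_trans h) //; apply: ler_wpM2r; first exact: ip_ge0.
by rewrite lerDl.
Qed.

End Evaluation.

(** * Words applied to a kernel vector *)

Section Words.
Context {R : realType}.

Lemma wact_dsum g d m n (X : 'I_g -> 'M[R]_m) (Y : 'I_g -> 'M[R]_n)
    (V : 'M[R]_(d, m)) (W : 'M[R]_(d, n)) w :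
  wact (dsum X Y) (row_mx V W) w = row_mx (wact X V w) (wact Y W w).
Proof.
elim: w V W => // j w IH V W.
by rewrite /wact /= mul_row_block !mulmx0 addr0 add0r -!/(wact _ _ _) IH.
Qed.

Lemma pact_dsum g d m n (p : ncpoly R g d) (X : 'I_g -> 'M[R]_m)
    (Y : 'I_g -> 'M[R]_n) V W :
  pact p (dsum X Y) (row_mx V W) = row_mx (pact p X V) (pact p Y W).
Proof.
rewrite /pact; elim/big_rec3: _ => [|w u v z _ ->]; first by rewrite row_mx0.
by rewrite wact_dsum mul_mx_row add_row_mx.
Qed.

Lemma wact0 g d n (X : 'I_g -> 'M[R]_n) w : wact X (0 : 'M[R]_(d, n)) w = 0.
Proof. by elim: w => // j w IH; rewrite /wact /= mul0mx. Qed.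

Lemma pact0 g d n (p : ncpoly R g d) (X : 'I_g -> 'M[R]_n) : pact p X 0 = 0.
Proof. by rewrite /pact big1 // => w _; rewrite wact0 mulmx0. Qed.

(* All the V w(X) with w of length at most D, stacked: the kernel vectors of p(X)
   become solutions of linear equations, which a compression to their row space
   preserves. *)
Definition wstack {g d n} (D : nat) (X : 'I_g -> 'M[R]_n) (V : 'M[R]_(d, n)) :
    'M[R]_(#|{: (D.-bseq 'I_g * 'I_d)%type}|, n) :=
  \matrix_(i, c) let wa : D.-bseq 'I_g * 'I_d := enum_val i in wact X V wa.1 wa.2 c.

Lemma row_wstack g d n D (X : 'I_g -> 'M[R]_n) (V : 'M[R]_(d, n)) i :
  row i (wstack D X V) =
  let wa : D.-bseq 'I_g * 'I_d := enum_val i in row wa.2 (wact X V wa.1).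
Proof. by apply/rowP => c; rewrite !mxE. Qed.

Lemma wstack_dsum g d m n D (X : 'I_g -> 'M[R]_m) (Y : 'I_g -> 'M[R]_n)
    (V : 'M[R]_(d, m)) (W : 'M[R]_(d, n)) :
  wstack D (dsum X Y) (row_mx V W) = row_mx (wstack D X V) (wstack D Y W).
Proof.
by apply/row_matrixP => i; rewrite row_row_mx !row_wstack /= wact_dsum row_row_mx.
Qed.

Lemma wstack_mulmx g d m n D (X : 'I_g -> 'M[R]_m) (Y : 'I_g -> 'M[R]_n)
    (V : 'M[R]_(d, m)) (W : 'M[R]_(d, n)) M :
  wstack D X V = wstack D Y W *m M <->
  forall w, (size w <= D)%N -> wact X V w = wact Y W w *m M.
Proof.
split=> H.
  move=> w wD; apply/row_matrixP => a.
  have := congr1 (row (enum_rank (Bseq wD, a))) H.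
  by rewrite !row_mul !row_wstack /= enum_rankK.
by apply/row_matrixP => i; rewrite row_mul !row_wstack /= H ?size_bseq // row_mul.
Qed.

Lemma wstack_eq0 g d n D (X : 'I_g -> 'M[R]_n) (V : 'M[R]_(d, n)) :
  wstack D X V = 0 -> V = 0.
Proof.
move=> H; have /wstack_mulmx /(_ [::] isT) : wstack D X V = wstack D X V *m 0.
  by rewrite mulmx0.
by rewrite mulmx0.
Qed.

(** The projection [I^T I] fixes the rows of [V w(X)] for words of length at most [D], so inserting
    it between letters changes nothing. *)
Lemma wstack_compress g d k n D (X : 'I_g -> 'M[R]_n) (V : 'M[R]_(d, n))
    (I : 'M[R]_(k, n)) Z w : I *m I^T = 1%:M -> wstack D X V = Z *m I ->
  (size w <= D)%N -> wact (compress I X) (V *m I^T) w = wact X V w *m I^T.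
Proof.
move=> II VZ; elim/last_ind: w => // w j IH; rewrite size_rcons => wD.
have /wstack_mulmx/(_ w (ltnW wD)) wE : wstack D X V = wstack D X V *m (I^T *m I).
  by rewrite VZ -!mulmxA (mulmxA I) II mul1mx.
move: IH => /(_ (ltnW wD)); rewrite /wact !foldl_rcons -!/(wact _ _ _) => ->.
by rewrite [in RHS]wE /compress !mulmxA.
Qed.

Lemma capture_poly g h l (A : 'I_g -> 'M[R]_l) (B : 'I_h -> 'M[R]_l) d (p : ncpoly R g d) :
  (forall n (X : 'I_g -> 'M[R]_n) V, shadow A B X -> pact p X V = 0 -> V = 0) ->
  exists l' (D : 'I_g -> 'M[R]_l'), [/\ (0 < l')%N, symfam D, pencil_psd A B 1%:M D &
    forall n (X : 'I_g -> 'M[R]_n) V, shadow_cl A B X -> pact p X V = 0 -> V != 0 ->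
      kills D X].
Proof.
move=> pP; pose m := (\max_(w <- msupp p) size (w : seq 'I_g))%N.
have wm (w : {fmonom 'I_g}) : w \in msupp p -> (size w <= m)%N.
  by move=> wp; rewrite /m (big_fsetD1 _ wp) leq_maxl.
pose S n (X : 'I_g -> 'M[R]_n) Z := exists2 V : 'M[R]_(d, n), Z = wstack m X V & pact p X V = 0.
have [||| l' [D [l'0 sD pD kD]]] := @capture_pencil R g h l A B _ S.
- move=> n n' X Y _ _ [V -> HV] [W -> HW]; exists (row_mx V W).
    by rewrite wstack_dsum.
  by rewrite pact_dsum HV HW row_mx0.
- move=> k n I X Z II [V ZE HV]; have cE := wstack_compress II (esym ZE).
  exists (V *m I^T).
    have : wstack m (compress I X) (V *m I^T) = wstack m X V *m I^T by apply/wstack_mulmx.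
    by rewrite -ZE -mulmxA II mulmx1.
  rewrite -[RHS](mul0mx _ I^T) -HV mulmx_suml; apply: eq_big_seq => w wp.
  by rewrite cE ?wm // mulmxA.
- move=> n X Z PX [V -> /(pP _ _ _ PX) ->].
  by apply/row_matrixP => i; rewrite row_wstack /= wact0 !row0.
exists l', D; split => // n X V cX HV V0; apply: (kD _ _ (wstack m X V)) => //.
  by exists V.
by apply: contraNneq V0 => /wstack_eq0 ->.
Qed.

End Words.

(** * Segments in the component of invertibility *)

Section Component.
Context {R : realType}.

Lemma scale_mxtup_continuous g n (X : mxtup R g n) :
  continuous (fun t : R => map_mx (fun M => t *: M) X).
Proof.
move=> t; apply/cvg_ballP => e e0.
have H j a b : \forall s \near t, ball (t * X 0 j a b) e (s * X 0 j a b).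
  have : (fun s : R => s * X 0 j a b) @ t --> t * X 0 j a b by apply: cvgMl; exact: cvg_id.
  by move=> /cvg_ballP/(_ e e0).
have Ft : Filter (nbhs t) by exact: nbhs_filter.
have := filter_forall Ft (fun j => filter_forall Ft (fun a => filter_forall Ft (H j a))).
move=> {}H; apply: (@filterS _ (nbhs t) _ _ _ _ H) => s {}H.
split=> // i j; rewrite !mxE; split=> // a b.
by rewrite !mxE (ord1 i).
Qed.

Lemma invset_segment g d n (p : ncpoly R g d) (X : mxtup R g n) : symtup X ->
  (forall t, 0 <= t <= 1 -> nceval p (map_mx (fun M => t *: M) X) \in unitmx) ->
  invset p n X.
Proof.
move=> sX pX; pose f (t : R) := map_mx (fun M => t *: M) X : mxtup R g n.
exists (f @` `[0, 1]); last first.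
  by exists 1; [rewrite /= in_itv /= ler01 lexx|apply/matrixP => i j; rewrite mxE scale1r].
split.
- by exists 0; [rewrite /= in_itv /= ler01 lexx|apply/matrixP => i j; rewrite !mxE scale0r].
- move=> _ [t + <-]; rewrite /= in_itv /= => t01; split; last exact: pX.
  by move=> j; rewrite mxE linearZ /= sX.
- apply: connected_continuous_connected; first exact: segment_connected.
  exact/continuous_subspaceT/scale_mxtup_continuous.
Qed.

End Component.

(** * The projection *)

Section Projection.
Context {R : realType}.

Lemma rowmxK g n (F : 'I_g -> 'M[R]_n.+1) : (\row_j F j : mxtup R g n) 0 = F.
Proof. by apply/funext => j; rewrite mxE. Qed.

Lemma free_proj_shadow g h l (A : 'I_(g + h) -> 'M[R]_l) (W : gseq R (g + h)) n
    (X : mxtup R g n) : symfam A -> eqgseq W (Dpencil A) ->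
  free_proj W n X <->
  shadow (fun j => A (lshift h j)) (fun j => A (rshift g j)) (X 0).
Proof.
move=> sA WA.
have linE (Y : mxtup R h n) U : lin A (row_mx X Y 0) U =
    lin (fun j => A (lshift h j)) (X 0) U + lin (fun j => A (rshift g j)) (Y 0) U.
  rewrite /lin big_split_ord; congr (_ + _); apply: eq_bigr => j _.
    by rewrite row_mxEl.
  by rewrite row_mxEr.
have symrow (Y : mxtup R h n) : symtup X -> symtup Y -> symtup (row_mx X Y).
  move=> sX sY j; case: (split_ordP j) => i ->; first by rewrite row_mxEl sX.
  by rewrite row_mxEr sY.
split=> [[sX [Y [sY]]]|[sX [Y [c [sY c0 H]]]]].
  rewrite WA => -[_ /posdef_uniform[c c0 H]]; split=> //; exists (Y 0), c; split => // U.
  have := H (rvec U); rewrite rvec_pencil // rvec_ip linE addrA.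
  by rewrite /ip trace_mx11 rvec_ip.
split=> //; exists (\row_j Y j).
have sY' : symtup (\row_j Y j : mxtup R h n) by move=> j; rewrite mxE sY.
split=> //; rewrite WA; split; first exact: symrow.
apply/posdef_pencilP => //; first exact: symrow.
move=> U U0; rewrite linE addrA rowmxK; apply: lt_le_trans (H U).
by rewrite mulr_gt0 // ip_gt0.
Qed.

Section Exit.
Variables (g h l : nat) (A : 'I_g -> 'M[R]_l) (B : 'I_h -> 'M[R]_l).

Lemma shadow_shrink n (X : 'I_g -> 'M[R]_n) s t : 0 <= s <= t ->
  shadow A B (fun j => t *: X j) -> shadow A B (fun j => s *: X j).
Proof.
move=> /andP[s0 st] Xt; have [t0|t0] := eqVneq t 0.
  by have -> : s = t by apply/le_anti; rewrite st t0 s0.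
have tp : 0 < t by rewrite lt_def t0 (le_trans s0 st).
have -> : (fun j => s *: X j) = (fun j => (s / t) *: (t *: X j)).
  by apply/funext => j; rewrite scalerA divfK.
apply: shadow_scale => //.
by rewrite divr_ge0 // ?(ltW tp) //= ler_pdivrMr // mul1r.
Qed.

(** The exit parameter is the supremum of the [t] in [0, 1] with [t X] in the shadow: scaling puts
    all smaller multiples inside, and openness keeps the supremum itself out. *)
Lemma shadow_exit n (X : 'I_g -> 'M[R]_n) : symfam X -> ~ shadow A B X ->
  exists t, [/\ 0 <= t <= 1, shadow_cl A B (fun j => t *: X j) &
    ~ shadow A B (fun j => t *: X j)].
Proof.
move=> sX nX; pose T := [set t | 0 <= t <= 1 /\ shadow A B (fun j => t *: X j)].
have X1 : (fun j => 1 *: X j) = X by apply/funext => j; rewrite scale1r.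
have T0 : T 0.
  split; first by rewrite lexx ler01.
  by under eq_fun do rewrite scale0r; exact: shadow0.
have T1 : has_sup T by split; [exists 0|exists 1 => t [/andP[]]].
have t0 : 0 <= sup T by apply: ub_le_sup => //; case: T1.
have t1 : sup T <= 1 by apply: sup_le_ub; [exists 0|move=> t [/andP[]]].
exists (sup T); split; first by rewrite t0 t1.
- split=> [|s /andP[s0 s1]]; first exact: symfamZ.
  have -> : (fun j => s *: (sup T *: X j)) = (fun j => (s * sup T) *: X j).
    by apply/funext => j; rewrite scalerA.
  have [tz|tz] := eqVneq (sup T) 0; first by rewrite tz mulr0; case: T0.
  have tp : 0 < sup T by rewrite lt_def tz.
  have e0 : 0 < (1 - s) * sup T by rewrite mulr_gt0 // subr_gt0.
  have [t [_ Xt] st] := sup_adherent e0 T1.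
  apply: shadow_shrink Xt; rewrite mulr_ge0 //=; apply: ltW; apply: le_lt_trans st.
  by rewrite mulrBl mul1r opprB addrC subrK.
- move=> Xt; have t1' : sup T < 1.
    by rewrite lt_neqAle t1 andbT; apply/eqP => tE; apply: nX; rewrite -X1 -tE.
  have [e e0] := shadow_open Xt sX.
  under eq_fun do rewrite -scalerDl; move=> Xe.
  have : T (sup T + Num.min e (1 - sup T)).
    split.
      apply/andP; split; first by rewrite addr_ge0 // le_min (ltW e0) subr_ge0.
      by rewrite -lerBrDl ge_min lexx orbT.
    apply: shadow_shrink Xe; rewrite addr_ge0 ?le_min ?(ltW e0) ?subr_ge0 //=.
    by rewrite lerD2l ge_min lexx.
  move=> /(ub_le_sup T1.2); rewrite gerDl leNgt lt_min e0 subr_gt0.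
  by rewrite t1'.
Qed.

Lemma capture_family k (d : 'I_k -> nat) (p : forall j, ncpoly R g (d j)) :
  (forall j n (X : 'I_g -> 'M[R]_n) V, shadow A B X -> pact (p j) X V = 0 -> V = 0) ->
  exists l' (D : 'I_g -> 'M[R]_l'), [/\ (0 < l')%N, symfam D, pencil_psd A B 1%:M D &
    forall j n (X : 'I_g -> 'M[R]_n) V, shadow_cl A B X -> pact (p j) X V = 0 ->
      V != 0 -> kills D X].
Proof.
move=> pP; suff H (s : seq 'I_k) :
    exists l' (D : 'I_g -> 'M[R]_l'), [/\ (0 < l')%N, symfam D, pencil_psd A B 1%:M D &
    forall j n (X : 'I_g -> 'M[R]_n) V, j \in s -> shadow_cl A B X ->
      pact (p j) X V = 0 -> V != 0 -> kills D X].
  have [l' [D [l'0 sD pD kD]]] := H (enum 'I_k).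
  by exists l', D; split => // j n X V; apply: kD; rewrite mem_enum.
elim: s => [|j s [l1 [D1 [l1p sD1 pD1 kD1]]]].
  by exists 1%N, (fun=> 0); split => //; [exact: symfam0|exact: pencil_psd_zero].
have [l2 [D2 [l2p sD2 pD2 kD2]]] := capture_poly (pP j).
exists (l1 + l2)%N, (dsum D1 D2); split.
- by rewrite addn_gt0 l1p.
- exact: symfam_dsum.
- exact: pencil_psd_dsum.
- move=> i n X V; rewrite inE => /orP[/eqP ij|js] cX HV V0.
    move: V HV V0; rewrite ij => V HV V0; by apply: kills_dsumr; exact: kD2 HV V0.
  by apply: kills_dsuml; exact: kD1 js cX HV V0.
Qed.

(* A direct sum of counterexamples, one for each B i, lies in some B i, on which
   the polynomials defining B i are invertible. *)
Lemma free_open_basic (P : gseq R g) :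
  (forall n (X : mxtup R g n), P n X <-> shadow A B (X 0)) -> free_open P ->
  exists k (d : 'I_k -> nat) (p : forall j, ncpoly R g (d j)),
    (forall j n (X : 'I_g -> 'M[R]_n) V, shadow A B X -> pact (p j) X V = 0 -> V = 0) /\
    forall n (X : mxtup R g n), symtup X -> (forall j, invset (p j) n X) -> P n X.
Proof.
move=> PE [k [BB [k0 basic PB]]].
(* A witness that [X] cannot lie in [BB i], stable under direct sums with any tuple. *)
pose Out i n (X : 'I_g -> 'M[R]_n) := exists d (p : ncpoly R g d),
  (forall m (Z : mxtup R g m), BB i m Z -> nceval p Z \in unitmx) /\
  exists2 V : 'M[R]_(d, n), V != 0 & pact p X V = 0.
have [[i Hi]|Hno] := pselect (exists i, forall n (X : 'I_g -> 'M[R]_n), shadow A B X -> ~ Out i n X).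
  have [m [d [p [pP BE]]]] := basic i.
  exists m, d, p; split=> [j n X V PX HV|n X sX HX].
    have [//|V0] := eqVneq V 0; exfalso; apply: (Hi n X PX).
    exists (d j), (p j); split; last by exists V.
    move=> q Z; rewrite BE => -[_ /(_ j I)] [C [_ CA _] CZ].
    by have [] := CA _ CZ.
  rewrite PB; exists i => //; rewrite BE; split => // j _; exact: HX.
exfalso.
have Hs (s : seq 'I_k) : exists n (X : 'I_g -> 'M[R]_n), shadow A B X /\
    forall i, i \in s -> Out i n X.
  elim: s => [|i s [n [X [PX HX]]]]; first by exists 0%N, (fun=> 0); split => //; exact: shadow0.
  have [m [Z [PZ [d [p [pP [V V0 HV]]]]]]] : exists n (X : 'I_g -> 'M[R]_n),
      shadow A B X /\ Out i n X.
    apply: contrapT => Hc; apply: Hno; exists i => q Y PY OY; apply: Hc.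
    by exists q, Y.
  exists (m + n)%N, (dsum Z X); split; first exact: shadow_dsum.
  move=> i'; rewrite inE => /orP[/eqP ->|/HX].
    exists d, p; split => //; exists (row_mx V 0).
      by rewrite row_mx_eq0 negb_and V0.
    by rewrite pact_dsum pact0 HV row_mx0.
  move=> [d' [p' [p'P [V' V'0 HV']]]]; exists d', p'; split => //.
  exists (row_mx 0 V'); first by rewrite row_mx_eq0 negb_and V'0 orbT.
  by rewrite pact_dsum pact0 HV' row_mx0.
(* The sum starts from the empty tuple of size 0; since [k > 0], some nonzero [V] exists, which
   excludes size 0. *)
have [[|n] [X [PX HX]]] := Hs (enum 'I_k).
  have [d [p [_ [V /eqP V0 _]]]] := HX (Ordinal k0) (mem_enum _ _).
  by apply: V0; apply/matrixP => ? [].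
have : P n (\row_j X j) by apply/PE; rewrite rowmxK.
rewrite PB => -[i _ HBi].
have [d [p [/(_ _ _ HBi) pu [V V0 HV]]]] := HX i (mem_enum _ _).
move: pu; apply/negP/nceval_unitPn; rewrite rowmxK; by exists V.
Qed.

End Exit.
End Projection.

(** * The pencil defining the projection *)

Theorem corollary9p7 (R : realType) (g h : nat) (W : gseq R (g + h)) :
  (0 < g)%N -> (0 < h)%N ->
  graded W ->
  bounded_gseq W ->
  has_LMI W ->
  free_open (free_proj W) ->
  has_LMI (free_proj W).
Proof.
move=> _ _ _ _ [l [A [_ sA WA]]] Pfree.
have PE n (X : mxtup R g n) := free_proj_shadow X sA WA.
have [k [d [p [pP pB]]]] := free_open_basic PE Pfree.
have [l' [D [l'0 sD pD kD]]] := capture_family pP.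
exists l', D; split => // n; apply/seteqP; split=> X.
  move=> /PE PX; have sX : symtup X := PX.1; split => //.
  apply/posdef_pencilP => // U U0.
  (* Positivity becomes strict because the form is still nonnegative at [(1 + e) X] and is positive
     at 0. *)
  have [e e0 Xe] := shadow_open PX sX.
  have := pD _ _ U Xe; rewrite mul1mx linXD linXZ !ipDl ipZl.
  have := ip_gt0 U0; move: (ip (lin _ _ U) U) (ip U U) => b a a0 H.
  have : 0 < (1 + e) * (a + b) by nra.
  by rewrite pmulr_rgt0 //; lra.
move=> [sX /(posdef_pencilP sD sX) XD]; apply/PE; apply: contrapT => nX.
have [t [/andP[t0 t1] cX nX']] := shadow_exit sX nX.
pose X' : mxtup R g n := \row_j (t *: X 0 j).
(* Otherwise every [p j] is invertible on the whole segment from 0 to [t X], which puts [t X] in the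
   projection. *)
have [j [V V0 HV]] : exists j, exists2 V, V != 0 & pact (p j) (X' 0) V = 0.
  apply: contrapT => Hno; apply: nX'; rewrite -(rowmxK (fun j => t *: X 0 j)).
  apply/PE; apply: pB; first by move=> j; rewrite mxE linearZ /= sX.
  move=> j; apply: invset_segment; first by move=> i; rewrite mxE linearZ /= sX.
  move=> s /andP[s0 s1]; apply: contraT => /nceval_unitPn [V V0 HV]; exfalso.
  move: HV; have -> : (map_mx (fun M => s *: M) X' : mxtup R g n) 0 = (fun j => s *: (t *: X 0 j)).
    by apply/funext => i; rewrite !mxE.
  have [->|sn1] := eqVneq s 1.
    under eq_fun do rewrite scale1r.
    by move=> HV; apply: Hno; exists j, V => //; rewrite rowmxK.
  have [_ /(_ s) Ps] := cX; move=> /(pP j _ _ _ (Ps _)) /eqP; rewrite (negPf V0).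
  by rewrite s0 lt_neqAle sn1 s1 => /(_ isT).
rewrite rowmxK in HV.
have [U U0 HU] := kD _ _ _ _ cX HV V0.
(* Along the ray the form at [U] is affine, positive at 0 and at [X], so it cannot vanish at
   [t X]. *)
have H := congr1 (ip ^~ U) HU; rewrite /= ip0l linXZ ipDl ipZl in H.
have := XD _ U0; rewrite ipDl; have := ip_gt0 U0.
move: (ip (lin _ _ U) U) (ip U U) H => b a H a0 ab.
have : 0 <= t * (a + b) by rewrite mulr_ge0 // ltW.
have [tE|tn] := eqVneq t 1; first by move: H; rewrite tE; lra.
have : 0 < (1 - t) * a by rewrite mulr_gt0 // subr_gt0 lt_neqAle tn.
by nra.
Qed.
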